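(* Let $Y\subseteq X$ be real Banach spaces ($Y$ a closed subspace) and $\lambda\ge1$. Then $Y$ is locally $\lambda$-complemented in $X$ if and only if there exists a Lipschitz map $h\colon X\to Y^{**}$ with Lipschitz constant at most $\lambda$ such that $h(y)=j(y)$ for all $y\in Y$, where $j\colon Y\to Y^{**}$ is the canonical embedding. Consequently, for every nice metric-algebraic category $\mathsf{Cat}_1\supseteq\mathsf{Banach}$, the equivalent conditions (1)–(4) below with respect to $\mathsf{Cat}_1$ hold if and only if they hold with respect to $\mathsf{Banach}$ (i.e. with morphisms being bounded linear operators), if and only if $Y$ is locally $\lambda$-complemented in $X$: (1) for every dual Banach space $Z^*$ and every $\mathsf{Cat}_1$-morphism $f\colon Y\to Z^*$ there is a $\mathsf{Cat}_1$-morphism $h\colon X\to Z^*$ extending $f$ with $\|h\|\le\lambda\|f\|$; (2) there is a $\mathsf{Cat}_1$-morphism $h\colon X\to Y^{**}$ with $\|h\|\le\lambda$ extending $j$; (3) for every $\varepsilon>0$ and finite $G\subseteq X$ there is a $\mathsf{Cat}_1$-object $V$ with $G\subseteq V\subseteq X$ (inherited structure) and a $\mathsf{Cat}_1$-morphism $\varphi\colon V\to Y$ with $\|\varphi\|\le\lambda(1+\varepsilon)$ and $\varphi(e)=e$ for $e\in V\cap Y$; (4) as (3) but only with $\|\varphi(e)-e\|<\varepsilon$ for $e\in V\cap Y$.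
   Context: $Y$ is locally $\lambda$-complemented in $X$ if for every finite-dimensional subspace $V\subseteq X$ and every $\varepsilon>0$ there is a linear operator $T\colon V\to Y$ with $T(v)=v$ for all $v\in V\cap Y$ and $\|T\|\le\lambda+\varepsilon$. A metric-algebraic category is specified by arities $n_i$ ($i\in I$) and axioms; objects are $(X,d,\{\sigma_i\})$ with $d$ a metric and $\sigma_i\colon X^{n_i}\to X$; morphisms are Lipschitz maps (norm = Lipschitz constant) commuting with the operations. $\mathsf{Cat}_2\subseteq\mathsf{Cat}_1$ means the operations and axioms of $\mathsf{Cat}_2$ contain those of $\mathsf{Cat}_1$. $\mathsf{Banach}$ is the category of real Banach spaces with operations the linear combinations and morphisms the bounded operators; $\mathsf{Metric}$ is pointed metric spaces with the base point as a $0$-ary operation and Lipschitz base-point-preserving maps as morphisms. $\mathsf{Cat}_1$ is nice if preimages under $\mathsf{Cat}_1$-morphisms of $\mathsf{Cat}_1$-subobjects (with inherited operations) are $\mathsf{Cat}_1$-objects with inherited operations. *)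

(* Defs.v *)
From HB Require Import structures.
From mathcomp Require Import all_boot all_order all_algebra.
From mathcomp Require Import all_classical all_reals all_analysis.
Set Implicit Arguments. Unset Strict Implicit. Unset Printing Implicit Defensive.
Import Order.TTheory GRing.Theory Num.Theory.
Import numFieldNormedType.Exports.
Local Open Scope classical_set_scope.
Local Open Scope ring_scope.

Section Defs.
Variable R : realType.

(* The Banach-space operation indexed by the coefficient list c : the
   (size c)-ary linear combination (x_k)_k |-> sum_k c_k x_k. *)
Definition lincomb (T : lmodType R) (c : seq R) (xs : 'I_(size c) -> T) : T :=
  \sum_(k < size c) c`_k *: xs k.

Record nsp := NSp { nT : lmodType R; ndom : set nT; nnorm : nT -> R }.
Arguments ndom : clear implicits.
Arguments nnorm : clear implicits.

(* the dual of a normed set: bounded linear functionals on ndom,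
   normalised to vanish outside ndom (canonical representatives) *)
Definition dual_dom (s : nsp) : set (nT s -> R) :=
  [set phi | (forall (a : R) x y, ndom s x -> ndom s y ->
                 phi (a *: x + y) = a * phi x + phi y)
          /\ (exists M : R, forall x, ndom s x -> `|phi x| <= M * nnorm s x)
          /\ (forall x, ~ ndom s x -> phi x = 0)].

Definition dual_norm (s : nsp) (phi : nT s -> R) : R :=
  sup [set `|phi x| | x in [set x | ndom s x /\ nnorm s x <= 1]].

Arguments dual_dom : clear implicits.
Arguments dual_norm : clear implicits.

Definition dual (s : nsp) : nsp := @NSp (nT s -> R)%type (dual_dom s) (dual_norm s).

Definition nsp_of (E : normedModType R) : nsp := @NSp E setT (fun x => `|x|).
Definition subnsp (E : normedModType R) (A : set E) : nsp :=
  @NSp E A (fun x => `|x|).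

Definition canj (X : normedModType R) (Y : set X) (y : X) : (X -> R) -> R :=
  fun phi => if `[< dual_dom (subnsp Y) phi >] then phi y else 0.

Definition is_subspace (X : lmodType R) (Y : set X) : Prop :=
  Y 0 /\ forall (a : R) x y, Y x -> Y y -> Y (a *: x + y).

Definition span_of (X : lmodType R) (s : seq X) : set X :=
  [set x | exists a : 'I_(size s) -> R, x = \sum_(k < size s) a k *: s`_k].

Definition findim_subspace (X : lmodType R) (V : set X) : Prop :=
  exists s : seq X, V = span_of s.

Definition opnorm_on (X : normedModType R) (V : set X) (T : X -> X) : R :=
  sup [set `|T v| | v in [set v | V v /\ `|v| <= 1]].

Definition loc_compl (X : normedModType R) (Y : set X) (lam : R) : Prop :=
  forall (V : set X), findim_subspace V -> forall eps : R, 0 < eps ->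
  exists T : X -> X,
    (forall v, V v -> Y (T v)) /\
    (forall (a : R) u v, V u -> V v -> T (a *: u + v) = a *: T u + T v) /\
    (forall v, V v -> Y v -> T v = v) /\
    opnorm_on V T <= lam + eps.

(* A metric-algebraic structure whose operation symbols form a subset O of
   the Banach operation symbols (coefficient lists); symbol c has arity
   size c. *)
Record mas (O : set (seq R)) := Mas {
  mcar : Type;
  mdist : mcar -> mcar -> R;
  mop : forall c : seq R, O c -> ('I_(size c) -> mcar) -> mcar }.

Definition is_metric (T : Type) (d : T -> T -> R) : Prop :=
  (forall x y, 0 <= d x y) /\ (forall x y, d x y = 0 <-> x = y) /\
  (forall x y, d x y = d y x) /\ (forall x y z, d x z <= d x y + d y z).

Definition mclosed (O : set (seq R)) (s : mas O) (W : set (mcar s)) : Prop :=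
  forall c (Hc : O c) (xs : 'I_(size c) -> mcar s),
    (forall k, W (xs k)) -> W (mop Hc xs).

Definition msub (O : set (seq R)) (s : mas O) (W : set (mcar s))
  (HW : mclosed W) : mas O :=
  @Mas O {x : mcar s | W x} (fun x y => mdist (sval x) (sval y))
    (fun c Hc xs => exist _ (mop Hc (fun k => sval (xs k)))
                      (HW c Hc _ (fun k => proj2_sig (xs k)))).

Definition mmorph (O : set (seq R)) (s1 s2 : mas O) (f : mcar s1 -> mcar s2)
  : Prop :=
  (exists L : R, forall x y, mdist (f x) (f y) <= L * mdist x y) /\
  (forall c (Hc : O c) xs, f (mop Hc xs) = mop Hc (fun k => f (xs k))).

Definition mas_banach (s : mas setT) : Prop :=
  exists (E : completeNormedModType R) (g : mcar s -> E),
    bijective g /\ (forall x y, `|g x - g y| = mdist x y) /\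
    (forall c (Hc : setT c) xs, g (mop Hc xs) = lincomb (fun k => g (xs k))).

Definition restrict (O : set (seq R)) (s : mas setT) : mas O :=
  @Mas O (mcar s) (@mdist _ s) (fun c _ xs => @mop _ s c I xs).

(* A metric-algebraic category Cat_1 with Cat_1 ⊇ Banach is given by a set O
   of Banach operation symbols and axioms Ax (a predicate on structures);
   objects are structures with a metric satisfying Ax. *)
Definition mobj (O : set (seq R)) (Ax : mas O -> Prop) (s : mas O) : Prop :=
  is_metric (@mdist _ s) /\ Ax s.

Definition contains_banach (O : set (seq R)) (Ax : mas O -> Prop) : Prop :=
  forall s : mas setT, mas_banach s -> mobj Ax (restrict O s).

Definition nice (O : set (seq R)) (Ax : mas O -> Prop) : Prop :=
  forall (s1 s2 : mas O) (f : mcar s1 -> mcar s2),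
    mobj Ax s1 -> mobj Ax s2 -> mmorph f ->
    forall (W : set (mcar s2)) (HW : mclosed W), mobj Ax (msub HW) ->
    forall HP : mclosed (f @^-1` W), mobj Ax (msub HP).

Definition Ax_banach : mas setT -> Prop := mas_banach.

Definition nclosed (O : set (seq R)) (s : nsp) : Prop :=
  forall c, O c -> forall xs : 'I_(size c) -> nT s,
    (forall k, ndom s (xs k)) -> ndom s (lincomb xs).

Definition to_mas (O : set (seq R)) (s : nsp) (H : nclosed O s) : mas O :=
  @Mas O {x : nT s | ndom s x} (fun x y => nnorm s (sval x - sval y))
    (fun c Hc xs => exist _ (lincomb (fun k => sval (xs k)))
                      (H c Hc _ (fun k => proj2_sig (xs k)))).

Definition nobj (O : set (seq R)) (Ax : mas O -> Prop) (s : nsp) : Prop :=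
  exists H : nclosed O s, mobj Ax (to_mas H).

Definition nmorph (O : set (seq R)) (s1 s2 : nsp) (f : nT s1 -> nT s2) : Prop :=
  (forall x, ndom s1 x -> ndom s2 (f x)) /\
  (exists L : R, forall x y, ndom s1 x -> ndom s1 y ->
      nnorm s2 (f x - f y) <= L * nnorm s1 (x - y)) /\
  (forall c, O c -> forall xs : 'I_(size c) -> nT s1,
      (forall k, ndom s1 (xs k)) -> f (lincomb xs) = lincomb (fun k => f (xs k))).

(* norm of a morphism = its Lipschitz constant *)
Definition lipc (s1 s2 : nsp) (f : nT s1 -> nT s2) : R :=
  inf [set L : R | 0 <= L /\ forall x y, ndom s1 x -> ndom s1 y ->
                    nnorm s2 (f x - f y) <= L * nnorm s1 (x - y)].

Definition cond1 (O : set (seq R)) (X : normedModType R) (Y : set X) (lam : R)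
  : Prop :=
  forall (Z : completeNormedModType R) (f : X -> (Z -> R)),
    @nmorph O (subnsp Y) (dual (nsp_of Z)) f ->
    exists h : X -> (Z -> R),
      @nmorph O (nsp_of X) (dual (nsp_of Z)) h /\
      (forall y, Y y -> h y = f y) /\
      @lipc (nsp_of X) (dual (nsp_of Z)) h
        <= lam * @lipc (subnsp Y) (dual (nsp_of Z)) f.

Definition cond2 (O : set (seq R)) (X : normedModType R) (Y : set X) (lam : R)
  : Prop :=
  exists h : X -> ((X -> R) -> R),
    @nmorph O (nsp_of X) (dual (dual (subnsp Y))) h /\
    @lipc (nsp_of X) (dual (dual (subnsp Y))) h <= lam /\
    (forall y, Y y -> h y = canj Y y).

Definition cond3 (O : set (seq R)) (Ax : mas O -> Prop) (X : normedModType R)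
  (Y : set X) (lam : R) : Prop :=
  forall eps : R, 0 < eps -> forall G : set X, finite_set G ->
  exists V : set X, G `<=` V /\ nobj Ax (subnsp V) /\
    exists phi : X -> X,
      @nmorph O (subnsp V) (subnsp Y) phi /\
      @lipc (subnsp V) (subnsp Y) phi <= lam * (1 + eps) /\
      (forall e, V e -> Y e -> phi e = e).

Definition cond4 (O : set (seq R)) (Ax : mas O -> Prop) (X : normedModType R)
  (Y : set X) (lam : R) : Prop :=
  forall eps : R, 0 < eps -> forall G : set X, finite_set G ->
  exists V : set X, G `<=` V /\ nobj Ax (subnsp V) /\
    exists phi : X -> X,
      @nmorph O (subnsp V) (subnsp Y) phi /\
      @lipc (subnsp V) (subnsp Y) phi <= lam * (1 + eps) /\
      (forall e, V e -> Y e -> `|phi e - e| < eps).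

End Defs.

Arguments ndom {R}.
Arguments nnorm {R}.
Arguments dual_dom {R}.
Arguments dual_norm {R}.

(* Main.v *)
Require Import Defs.
From HB Require Import structures.
From mathcomp Require Import all_boot all_order all_algebra.
From mathcomp Require Import all_classical all_reals all_analysis.
From mathcomp Require Import lra ring.
Import Order.TTheory GRing.Theory Num.Theory.
Import numFieldNormedType.Exports.
Set Implicit Arguments.
Unset Strict Implicit.
Unset Printing Implicit Defensive.
Local Open Scope classical_set_scope.
Local Open Scope ring_scope.

(** From local complementation, operators [V -> Y] with norm at most
    [lam + 1/n] on larger and larger finite-dimensional [V] converge weak* along
    an ultrafilter; composing them with a morphism [Y -> Z*] before passing to the
    limit gives every extension property.  Conversely, from each condition one
    extracts a Lipschitz map [h : X -> Y**] extending the canonical embedding.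
    Averaging the increments of [h] with invariant means over [Y] and [X] makes
    it linear without losing the constant or the values on [Y], and the
    principle of local reflexivity brings a linear map [X -> Y**] back to
    operators [V -> Y]: by Hahn-Banach, the distance from a finite family in [Y]
    to the families produced by admissible operators is tested by finitely many
    functionals, on which the map into [Y**] can be evaluated. *)

(** * Normed subsets and Lipschitz constants *)

Section NormedSets.
Context {R : realType}.
Implicit Types s : nsp R.

(** Every condition is compared with [loc_compl], which does not mention the category. A morphism
    may be far from linear: to reach [loc_compl], only its Lipschitz bound and its values on [Y] are
    used; in the other direction it is composed with linear operators, which commute with every
    linear combination and hence with the symbols of any [O]. Two means are needed because, for
    [phi] in the dual of [Y], the functional values of [h] on a coset [z + Y] differ from a copy of
    [phi] by a bounded function whose bound grows with [|z|]. The mean over [Y] cancels this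
    perturbation inside each coset; the mean over [X] then yields additivity. Subspaces and duals
    are sets inside ambient types, so linearity is relative to a set and functionals on [Y] are
    functions on [X] that vanish off [Y]. An actual Banach space type is built only where one is
    demanded: for the dual of [Y] as an instance of [Z] in condition (1), and to certify that
    finite-dimensional spans are objects. *)

Definition normed_nsp s : Prop :=
  [/\ is_subspace (ndom s),
      (forall a x, ndom s x -> nnorm s (a *: x) = `|a| * nnorm s x) &
      (forall x y, ndom s x -> ndom s y ->
         nnorm s (x + y) <= nnorm s x + nnorm s y)].

Lemma subspaceD (E : lmodType R) (V : set E) x y :
  is_subspace V -> V x -> V y -> V (x + y).
Proof. by move=> [_ VZD] Vx Vy; rewrite -[x]scale1r; exact: VZD. Qed.

Lemma subspaceZ (E : lmodType R) (V : set E) a x :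
  is_subspace V -> V x -> V (a *: x).
Proof. by move=> [V0 VZD] Vx; rewrite -[_ *: _]addr0; exact: VZD. Qed.

Lemma subspaceN (E : lmodType R) (V : set E) x :
  is_subspace V -> V x -> V (- x).
Proof. by move=> VS Vx; rewrite -scaleN1r; exact: subspaceZ. Qed.

Lemma subspaceB (E : lmodType R) (V : set E) x y :
  is_subspace V -> V x -> V y -> V (x - y).
Proof. by move=> VS Vx Vy; apply: subspaceD => //; exact: subspaceN. Qed.

Lemma subspace_sum (E : lmodType R) (V : set E) (I : Type) (r : seq I)
    (P : pred I) (x : I -> E) :
  is_subspace V -> (forall i, P i -> V (x i)) -> V (\sum_(i <- r | P i) x i).
Proof.
move=> VS Vx; elim/big_ind: _ => //; first by case: VS.
by move=> u v; exact: subspaceD.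
Qed.

Section linear_on.
Variables (E F : lmodType R) (V : set E) (T : E -> F).
Hypotheses (VS : is_subspace V)
  (Tlin : forall (a : R) u v, V u -> V v -> T (a *: u + v) = a *: T u + T v).

Lemma linear_on0 : T 0 = 0.
Proof.
have V0 : V 0 by case: VS.
have := Tlin 1 V0 V0; rewrite !scale1r addr0 => /eqP.
by rewrite -subr_eq0 opprD addrA subrr add0r oppr_eq0 => /eqP.
Qed.

Lemma linear_onD u v : V u -> V v -> T (u + v) = T u + T v.
Proof. by move=> Vu Vv; rewrite -[u in LHS]scale1r Tlin// scale1r. Qed.

Lemma linear_onZ a u : V u -> T (a *: u) = a *: T u.
Proof.
move=> Vu; rewrite -[_ *: u]addr0 Tlin//; last by case: VS.
by rewrite linear_on0 addr0.
Qed.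

Lemma linear_onB u v : V u -> V v -> T (u - v) = T u - T v.
Proof.
move=> Vu Vv; rewrite linear_onD//; last exact: subspaceN.
by rewrite -scaleN1r linear_onZ// scaleN1r.
Qed.

Lemma linear_on_sum (I : Type) (r : seq I) (a : I -> R) (x : I -> E) :
  (forall i, V (x i)) ->
  T (\sum_(i <- r) a i *: x i) = \sum_(i <- r) a i *: T (x i).
Proof.
move=> Vx; elim: r => [|i r IH]; first by rewrite !big_nil linear_on0.
rewrite !big_cons Tlin ?IH//.
by apply: subspace_sum => // j _; exact: subspaceZ.
Qed.

Lemma linear_on_lincomb c (xs : 'I_(size c) -> E) : (forall k, V (xs k)) ->
  T (lincomb xs) = lincomb (fun k => T (xs k)).
Proof. by move=> Vxs; rewrite /lincomb linear_on_sum. Qed.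

End linear_on.

Lemma setT_subspace (E : lmodType R) : is_subspace [set: E].
Proof. by []. Qed.

Lemma nnorm0 s : normed_nsp s -> nnorm s 0 = 0.
Proof.
by move=> [[s0 _] sZ _]; rewrite -(scale0r (0 : nT s)) sZ// normr0 mul0r.
Qed.

Lemma nnormN s x : normed_nsp s -> ndom s x -> nnorm s (- x) = nnorm s x.
Proof. by move=> [_ sZ _] sx; rewrite -scaleN1r sZ// normrN1 mul1r. Qed.

Lemma nnorm_ge0 s x : normed_nsp s -> ndom s x -> 0 <= nnorm s x.
Proof.
move=> sN sx; have [sS _ sD] := sN.
have := sD x (- x) sx (subspaceN sS sx).
by rewrite subrr nnorm0// nnormN// -mulr2n pmulrn_lge0.
Qed.

(** * Dual norms of seminormed sets *)

Section dual.
Variable s : nsp R.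
Hypothesis sN : normed_nsp s.
Let sS : is_subspace (ndom s). Proof. by case: sN. Qed.

(** Viewing [R] as the module [R^o] over itself puts functionals under the [linear_on] lemmas. *)
Lemma dual_dom_lin phi : dual_dom s phi ->
  forall (a : R) x y, ndom s x -> ndom s y ->
    (phi (a *: x + y) : R^o) = a *: (phi x : R^o) + phi y.
Proof. by case. Qed.

Lemma dual_norm_has_sup phi : dual_dom s phi ->
  has_sup [set `|phi x| | x in [set x | ndom s x /\ nnorm s x <= 1]].
Proof.
move=> [_ [[M phiM] _]]; split.
  exists `|phi 0|, 0 => //; split; first by case: sS.
  by rewrite nnorm0.
exists `|M| => _ [x [sx x1] <-]; apply: (le_trans (phiM _ sx)).
apply: (le_trans (ler_norm _)); rewrite normrM ler_piMr//.
by rewrite ger0_norm// nnorm_ge0.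
Qed.

Lemma dual_norm_ge phi x : dual_dom s phi -> ndom s x ->
  `|phi x| <= dual_norm s phi * nnorm s x.
Proof.
move=> sphi sx; have [phil [[M phiM] _]] := sphi.
(* The norm is only a seminorm here, so [x] may be nonzero; the bound [M] then forces [phi x] to
   vanish. *)
have [x0|x0] := eqVneq (nnorm s x) 0.
  by have := phiM _ sx; rewrite x0 !mulr0.
have xp : 0 < nnorm s x by rewrite lt_neqAle eq_sym x0 nnorm_ge0.
rewrite -ler_pdivrMr//.
have -> : `|phi x| / nnorm s x = `|phi ((nnorm s x)^-1 *: x)|.
  rewrite (linear_onZ sS (dual_dom_lin sphi))// normrM mulrC.
  by rewrite ger0_norm// invr_ge0 ltW.
apply: sup_upper_bound; first exact: dual_norm_has_sup.
exists ((nnorm s x)^-1 *: x) => //; split; first exact: subspaceZ.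
case: sN => _ -> // _; rewrite ger0_norm ?invr_ge0 ?(ltW xp)//.
by rewrite mulVf.
Qed.

Lemma dual_norm_le phi C : 0 <= C ->
  (forall x, ndom s x -> `|phi x| <= C * nnorm s x) -> dual_norm s phi <= C.
Proof.
move=> C0 phiC; apply: ge_sup.
  exists `|phi 0|, 0 => //; split; first by case: sS.
  by rewrite nnorm0.
move=> _ [x [sx x1] <-]; apply: (le_trans (phiC _ sx)).
by rewrite ler_piMr.
Qed.

Lemma dual_norm_ge0 phi : dual_dom s phi -> 0 <= dual_norm s phi.
Proof.
move=> sphi; apply: (le_trans (normr_ge0 (phi 0))).
apply: sup_upper_bound; first exact: dual_norm_has_sup.
by exists 0 => //; split; [case: sS|rewrite nnorm0].
Qed.

Lemma dual_dom_subspace : is_subspace (dual_dom s).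
Proof.
split.
  split; first by move=> a x y _ _ /=; rewrite mulr0 addr0.
  by split; [exists 0 => x _; rewrite normr0 mul0r|].
move=> a f g [fl [[M fM] f0]] [gl [[N gN] g0]]; split.
  move=> b x y sx sy; rewrite !fctE fl// gl//= /GRing.scale/=; ring.
split; last by move=> x sx; rewrite !fctE f0// g0// scaler0 addr0.
exists (`|a| * M + N) => x sx; rewrite !fctE /GRing.scale/=.
apply: (le_trans (ler_normD _ _)); rewrite normrM mulrDl -mulrA.
by apply: lerD; [rewrite ler_wpM2l ?fM|exact: gN].
Qed.

Lemma normed_dual : normed_nsp (dual s).
Proof.
split; first exact: dual_dom_subspace.
  move=> a f sf /=; have [->|a0] := eqVneq a 0.
    rewrite normr0 mul0r; apply/eqP; rewrite eq_le dual_norm_ge0 ?andbT.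
      by apply: dual_norm_le => // x sx; rewrite scale0r normr0 mul0r.
    by apply: subspaceZ => //; exact: dual_dom_subspace.
  have saf : dual_dom s (a *: f).
    by apply: subspaceZ => //; exact: dual_dom_subspace.
  apply/eqP; rewrite eq_le; apply/andP; split.
    apply: dual_norm_le; first by rewrite mulr_ge0 ?dual_norm_ge0.
    move=> x sx; rewrite fctE normrM -mulrA ler_wpM2l//.
    exact: dual_norm_ge.
  rewrite -ler_pdivlMl ?normr_gt0//; apply: dual_norm_le.
    by rewrite mulr_ge0 ?dual_norm_ge0// invr_ge0.
  move=> x sx; rewrite -mulrA ler_pdivlMl ?normr_gt0// -normrM.
  exact: (dual_norm_ge saf sx).
move=> f g sf sg /=; apply: dual_norm_le.
  by rewrite addr_ge0 ?dual_norm_ge0.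
move=> x sx; rewrite fctE mulrDl; apply: (le_trans (ler_normD _ _)).
by apply: lerD; exact: dual_norm_ge.
Qed.

End dual.

(** * Lipschitz constants as attained infima *)

Section lipc.
Variables (s1 s2 : nsp R) (f : nT s1 -> nT s2).

Lemma lipc_le L : 0 <= L ->
  (forall x y, ndom s1 x -> ndom s1 y ->
    nnorm s2 (f x - f y) <= L * nnorm s1 (x - y)) -> @lipc R s1 s2 f <= L.
Proof.
move=> L0 fL; apply: ge_inf; last by split.
by exists 0 => M [].
Qed.

Hypothesis fL : exists L, forall x y, ndom s1 x -> ndom s1 y ->
    nnorm s2 (f x - f y) <= L * nnorm s1 (x - y).
Hypothesis s1_ge0 : forall x y, ndom s1 x -> ndom s1 y -> 0 <= nnorm s1 (x - y).

Let lip_set_has_inf : has_inf [set L : R | 0 <= L /\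
  forall x y, ndom s1 x -> ndom s1 y ->
    nnorm s2 (f x - f y) <= L * nnorm s1 (x - y)].
Proof.
split; last by exists 0 => M [].
have [L LP] := fL; exists `|L|; split=> // x y sx sy.
apply: (le_trans (LP _ _ sx sy)); rewrite ler_wpM2r ?ler_norm//.
exact: s1_ge0.
Qed.

Lemma lipc_ge0 : 0 <= @lipc R s1 s2 f.
Proof. by apply: lb_le_inf; [case: lip_set_has_inf|move=> M []]. Qed.

Lemma lipcP x y : ndom s1 x -> ndom s1 y ->
  nnorm s2 (f x - f y) <= @lipc R s1 s2 f * nnorm s1 (x - y).
Proof.
move=> sx sy; have := s1_ge0 sx sy; rewrite le_eqVlt => /orP[/eqP e|p].
  by have [L LP] := fL; have := LP _ _ sx sy; rewrite -e !mulr0.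
rewrite -ler_pdivrMr//; apply: lb_le_inf; first by case: lip_set_has_inf.
by move=> M [_ MP]; rewrite ler_pdivrMr//; exact: MP.
Qed.

End lipc.

Lemma normed_nsp_of (E : normedModType R) : normed_nsp (nsp_of E).
Proof.
by split; [|move=> a x _; exact: normrZ|move=> x y _ _; exact: ler_normD].
Qed.

Lemma normed_subnsp (E : normedModType R) (A : set E) :
  is_subspace A -> normed_nsp (subnsp A).
Proof.
by split; [|move=> a x _; exact: normrZ|move=> x y _ _; exact: ler_normD].
Qed.

End NormedSets.

(** * Ultrafilter limits and invariant means *)

Section GeneralizedLimits.
Context {R : realType} {I : Type} (U : set_system I) {UU : UltraFilter U}.
Implicit Types f g : I -> R.

Definition ubdd g := exists B : R, \forall i \near U, `|g i| <= B.

Definition glim g : R := lim (g @ U).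

(** Compactness of an interval gives the image of [U] a cluster point, and an ultrafilter converges
    to each of its cluster points. *)
Lemma cvg_glim g : ubdd g -> g @ U --> glim g.
Proof.
move=> [B gB].
have [|p [_ clp]] := @segment_compact R (- B) B (g @ U) _.
  by apply: filterS gB => i /=; rewrite in_itv/= ler_norml.
suff gp : g @ U --> p by apply/cvg_ex; exists p.
move=> A Ap; have [//|UA] := in_ultra_setVsetC (g @^-1` A) UU.
by have [r [rA]] := clp (~` A) A UA Ap.
Qed.

Lemma glim_near_cst c g : (\forall i \near U, g i = c) -> glim g = c.
Proof.
by move=> gc; apply: cvg_lim => //; apply: cvg_near_cst.
Qed.

Lemma glim_lin a f g : ubdd f -> ubdd g ->
  glim (fun i => a * f i + g i) = a * glim f + glim g.
Proof.
move=> /cvg_glim fl /cvg_glim gl; apply: cvg_lim => //.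
by apply: cvgD => //; apply: cvgMr.
Qed.

Lemma glim_norm_le C g : (\forall i \near U, `|g i| <= C) -> `|glim g| <= C.
Proof.
move=> gC; have gl : g @ U --> glim g by apply: cvg_glim; exists C.
exact: cvgr_to_le (cvg_norm gl) gC.
Qed.

Lemma ubdd_lin a f g : ubdd f -> ubdd g -> ubdd (fun i => a * f i + g i).
Proof.
move=> [B fB] [C gC]; exists (`|a| * B + C); near=> i.
apply: (le_trans (ler_normD _ _)); rewrite normrM.
apply: lerD; last by near: i.
by rewrite ler_wpM2l//; near: i.
Unshelve. all: by end_near. Qed.

Lemma glimB f g : ubdd f -> ubdd g ->
  glim (fun i => f i - g i) = glim f - glim g.
Proof.
move=> fb gb; rewrite -[in RHS]mulN1r [RHS]addrC -glim_lin//.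
by congr glim; apply/funext => i; rewrite mulN1r addrC.
Qed.

Lemma glim_near_eq f g : ubdd f -> ubdd g -> (\forall i \near U, f i = g i) ->
  glim f = glim g.
Proof.
move=> fb gb fg; apply/eqP; rewrite -subr_eq0 -glimB//; apply/eqP.
by apply: glim_near_cst; apply: filterS fg => i ->; rewrite subrr.
Qed.

Lemma ubdd_glim_sum (J : Type) (r : seq J) (a : J -> R) (f : J -> I -> R) :
  (forall j, ubdd (f j)) -> ubdd (fun i => \sum_(j <- r) a j * f j i) /\
  glim (fun i => \sum_(j <- r) a j * f j i) = \sum_(j <- r) a j * glim (f j).
Proof.
move=> fb; elim: r => [|j r [rb rE]].
  split; first by exists 0; apply: nearW => i; rewrite big_nil normr0.
  by apply: glim_near_cst; apply: nearW => i; rewrite !big_nil.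
under eq_fun do rewrite big_cons.
by split; [exact: ubdd_lin|rewrite glim_lin// rE big_cons].
Qed.

End GeneralizedLimits.

(** An index is a finite list of points on which an approximation is controlled, together with an
    integer measuring its precision. [F] is the filter of tails of this directed set. *)
Lemma large_ultrafilter (T : choiceType) : exists U : set_system (seq T * nat),
  [/\ UltraFilter U, forall x, \forall i \near U, x \in i.1 &
      forall n, \forall i \near U, (n <= i.2)%N].
Proof.
pose F : set_system (seq T * nat) := [set A | exists (s : seq T) (n : nat),
  forall i : seq T * nat, {subset s <= i.1} -> (n <= i.2)%N -> A i].
have FF : ProperFilter F.
  split; first by move=> [s [n sn]]; exact: (sn (s, n)).
  split; first by exists [::], 0%N.
    move=> A B [s [n An]] [t [m Bm]]; exists (s ++ t), (maxn n m) => i si.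
    rewrite geq_max => /andP[ni mi].
    split; [apply: An|apply: Bm] => // x xs; apply: si.
      by rewrite mem_cat xs.
    by rewrite mem_cat xs orbT.
  by move=> A B AB [s [n An]]; exists s, n => i si ni; apply: AB; exact: An.
have [U [UU FU]] := ultraFilterLemma FF; exists U; split=> //.
  by move=> x; apply: FU; exists [:: x], 0%N => i + _; apply; rewrite inE.
by move=> n; apply: FU; exists [::], n.
Qed.

(** * Invariant means on commutative monoids *)

Section InvariantMean.
Context {R : realType} {G : zmodType}.
Implicit Types (f g : G -> R) (S : set G).

Definition bdd_on S g := exists B : R, forall z, S z -> `|g z| <= B.

Definition avg1 N (x : G) g : G -> R :=
  fun z => N.+1%:R^-1 * \sum_(n < N.+1) g (z + x *+ n).

(** The average over a Følner box: all translates by sums of multiples of the elements of [s], each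
    multiplicity running from 0 to [N]. *)
Definition avg N (s : seq G) g := foldr (avg1 N) g s.

Lemma avg_lin N s a f g :
  avg N s (fun z => a * f z + g z) = fun z => a * avg N s f z + avg N s g z.
Proof.
elim: s => [//|x s IH]; rewrite /= IH; apply/funext => z; rewrite /avg1.
by rewrite big_split/= mulrDr -mulr_sumr mulrCA.
Qed.

Lemma avg_cst N s c : avg N s (fun=> c) = fun=> c.
Proof.
elim: s => [//|x s IH]; rewrite /= IH; apply/funext => z; rewrite /avg1.
by rewrite sumr_const card_ord -[c *+ _]mulr_natl mulrA mulVf ?mul1r// pnatr_eq0.
Qed.

Lemma avg_shift N s g x : avg N s (fun z => g (z + x)) =
  fun z => avg N s g (z + x).
Proof.
elim: s => [//|y s IH]; rewrite /= IH; apply/funext => z; rewrite /avg1.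
by congr (_ * _); apply: eq_bigr => n _; rewrite addrAC.
Qed.

Variable S : set G.
Hypotheses (S0 : S 0) (SD : forall x y, S x -> S y -> S (x + y)).

Let SMn x n : S x -> S (x *+ n).
Proof.
by move=> Sx; elim: n => [|n IH]; rewrite ?mulr0n// mulrS; exact: SD.
Qed.

Lemma avg1_bound N x g B : S x -> (forall z, S z -> `|g z| <= B) ->
  forall z, S z -> `|avg1 N x g z| <= B.
Proof.
move=> Sx gB z Sz; rewrite /avg1 normrM ger0_norm ?invr_ge0//.
rewrite ler_pdivrMl ?ltr0n//; apply: (le_trans (ler_norm_sum _ _ _)).
rewrite mulr_natl -[X in B *+ X]card_ord -sumr_const; apply: ler_sum => n _.
by apply: gB; apply: SD => //; exact: SMn.
Qed.

Lemma avg_bound N s g B : (forall x, x \in s -> S x) ->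
  (forall z, S z -> `|g z| <= B) -> forall z, S z -> `|avg N s g z| <= B.
Proof.
move=> + gB; elim: s => [_|x s IH sS] //=.
apply: avg1_bound; first by apply: sS; rewrite inE eqxx.
by apply: IH => y ys; apply: sS; rewrite inE ys orbT.
Qed.

(** Averaging an increment in its own direction [x] telescopes to two boundary terms, each at most
    [B], over [N.+1]; averaging in the other directions cannot enlarge the bound. *)
Lemma avg_diff N s x g B : (forall x, x \in s -> S x) -> x \in s ->
  (forall z, S z -> `|g z| <= B) -> forall z, S z ->
  `|avg N s (fun z => g (z + x) - g z) z| <= 2 * B / N.+1%:R.
Proof.
move=> + + gB; elim: s => [//|y s IH] sS.
have Sy : S y by apply: sS; rewrite inE eqxx.
have {}sS z : z \in s -> S z by move=> zs; apply: sS; rewrite inE zs orbT.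
rewrite inE => /orP[/eqP xy z Sz|xs] /=; last by apply: avg1_bound => //; exact: IH.
pose h := avg N s g.
have -> : avg N s (fun z => g (z + x) - g z) = fun z => h (z + x) - h z.
  have -> : (fun z => g (z + x) - g z) = fun z => -1 * g z + g (z + x).
    by apply/funext => ?; rewrite mulN1r addrC.
  by rewrite avg_lin avg_shift; apply/funext => ?; rewrite mulN1r addrC.
rewrite /avg1 -xy.
have -> : \sum_(n < N.+1) (h (z + x *+ n + x) - h (z + x *+ n)) =
    h (z + x *+ N.+1) - h z.
  rewrite -(big_mkord xpredT (fun n => h (z + x *+ n + x) - h (z + x *+ n))).
  under eq_bigr do rewrite -addrA -mulrSr.
  by rewrite telescope_sumr// mulr0n addr0.
rewrite normrM ger0_norm ?invr_ge0// mulrC ler_wpM2r ?invr_ge0//.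
have hB u : S u -> `|h u| <= B by exact: avg_bound.
rewrite mulr_natl mulr2n; apply: (le_trans (ler_normB _ _)).
apply: lerD; apply: hB => //; apply: SD => //; apply: SMn.
by rewrite xy.
Qed.

(** The mean is the ultrafilter limit of box averages at 0; [avg_diff] makes a function and its
    translate indistinguishable in the limit. Functions live on all of [G], but only their values on
    [S] count, so the means over [Y] and over [X] are both instances with [G = X]. *)
Lemma invariant_mean : exists m : (G -> R) -> R,
  [/\ forall a f g, bdd_on S f -> bdd_on S g ->
        m (fun z => a * f z + g z) = a * m f + m g,
      forall g C, (forall z, S z -> `|g z| <= C) -> `|m g| <= C,
      forall c, m (fun=> c) = c &
      forall g x, bdd_on S g -> S x -> m (fun z => g (z + x)) = m g].
Proof.
have [U [UU Us Un]] := large_ultrafilter G.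
(* Directions outside [S] are discarded, so that averages based at 0 only sample points of [S]. *)
pose sS (i : seq G * nat) := [seq x <- i.1 | `[<S x>]].
have sSS i x : x \in sS i -> S x by rewrite mem_filter => /andP[/asboolP].
pose a g (i : seq G * nat) := avg i.2 (sS i) g 0.
have ab g C : (forall z, S z -> `|g z| <= C) -> forall i, `|a g i| <= C.
  by move=> gC i; apply: avg_bound => //; exact: sSS.
have abd g : bdd_on S g -> ubdd U (a g).
  by move=> [B gB]; exists B; apply: nearW; exact: ab.
exists (fun g => glim U (a g)); split.
- move=> k f g fb gb; rewrite -glim_lin; [|exact: abd..].
  by congr glim; apply/funext => i; rewrite /a avg_lin.
- by move=> g C gC; apply: glim_norm_le; apply: nearW; exact: ab.
- by move=> c; apply: glim_near_cst; apply: nearW => i; rewrite /a avg_cst.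
- move=> g x [B gB] Sx; apply/eqP; rewrite -subr_eq0 -glimB.
  + rewrite -normr_eq0 eq_le normr_ge0 andbT; apply/ler_addgt0Pl => e e0.
    rewrite addr0; apply: glim_norm_le.
    have [k kB] : exists k, 2 * B / k.+1%:R <= e.
      have B0 : 0 <= B by apply: le_trans (gB _ S0).
      exists (Num.truncn (2 * B / e)); rewrite ler_pdivrMr// -ler_pdivrMl// mulrC.
      exact/ltW/truncnS_gt.
    near=> i.
    have -> : a (fun z => g (z + x)) i - a g i =
        avg i.2 (sS i) (fun z => g (z + x) - g z) 0.
      have -> : (fun z => g (z + x) - g z) = fun z => -1 * g z + g (z + x).
        by apply/funext => ?; rewrite mulN1r addrC.
      by rewrite avg_lin mulN1r addrC.
    apply: (le_trans (avg_diff _ (sSS i) _ gB S0)).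
      rewrite mem_filter asboolT//=; near: i; exact: Us.
    apply: le_trans kB; rewrite ler_wpM2l//.
      by rewrite mulr_ge0//; apply: le_trans (gB _ S0).
    rewrite lef_pV2 ?posrE ?ltr0n// ler_nat ltnS; near: i; exact: Un.
  + by apply: abd; exists B => z Sz; apply: gB; exact: SD.
  + by apply: abd; exists B.
Unshelve. all: by end_near. Qed.

End InvariantMean.

(** * The Hahn-Banach theorem *)

Section HahnBanach.
Context {R : realType} {E : lmodType R} (q : E -> R).
Hypotheses (qD : forall x y, q (x + y) <= q x + q y)
  (qZ : forall (a : R) x, q (a *: x) = `|a| * q x).

Let q_ge0 x : 0 <= q x.
Proof.
have q0 : q 0 = 0 by rewrite -(scale0r (0 : E)) qZ normr0 mul0r.
have := qD x (-1 *: x); rewrite qZ normrN1 mul1r scaleN1r subrr q0.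
by rewrite -mulr2n pmulrn_lge0.
Qed.

Let dominated (g : set (E * R)) :=
  [/\ forall (a : R) u v, g u -> g v -> g (a *: u.1 + v.1, a * u.2 + v.2) &
      forall u, g u -> u.2 <= q u.1].

(* Zorn's lemma is applied to graphs of functionals: a subspace of [E * R]
   below [q] is automatically single valued. *)
Lemma hahn_banach p : exists f : E -> R,
  [/\ forall (a : R) x y, f (a *: x + y) = a * f x + f y,
      forall x, f x <= q x & f p = q p].
Proof.
pose line := [set u : E * R | exists t : R, u = (t *: p, t * q p)].
have lined : dominated line.
  split=> [a _ _ [t ->] [t' ->]|_ [t ->]] /=.
    by exists (a * t + t'); rewrite scalerDl scalerA mulrDl mulrA.
  by rewrite qZ ler_wpM2r// ler_norm.
(* Adjoining [line] makes [P] hold for the union of the empty chain, and imposes the value [q p] at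
   [p] on every graph. *)
pose P (g : set (E * R)) := dominated (g `|` line).
have [|g [Pg gmax]] := @Zorn_bigcup _ P.
  move=> F FP Ftot; have [->|/set0P[h0 Fh0]] := eqVneq F set0.
    by rewrite /P bigcup_set0 set0U.
  have FU u v : (\bigcup_(h in F) h `|` line) u ->
      (\bigcup_(h in F) h `|` line) v ->
      exists2 h, F h & (h `|` line) u /\ (h `|` line) v.
    move=> [[h Fh hu]|lu] [[k Fk kv]|lv].
    - have [hk|kh] := Ftot _ _ Fh Fk.
        by exists k => //; split; left => //; exact: hk.
      by exists h => //; split; left => //; exact: kh.
    - by exists h => //; split; [left|right].
    - by exists k => //; split; [right|left].
    - by exists h0 => //; split; right.
  split=> [a u v gu gv|u gu].
    have [h Fh [hu hv]] := FU _ _ gu gv.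
    have [/(_ a u v hu hv)[hw|lw] _] := FP _ Fh; last by right.
    by left; exists h.
  by have [h Fh [hu _]] := FU _ _ gu gu; have [_ /(_ _ hu)] := FP _ Fh.
pose G := g `|` line; have [Glin Gq] : dominated G by [].
have G0 : G (0, 0) by right; exists 0; rewrite scale0r mul0r.
have GZ a u : G u -> G (a *: u.1, a * u.2).
  by move=> Gu; have := Glin a _ _ Gu G0; rewrite /= !addr0.
have GB u v : G u -> G v -> G (v.1 - u.1, v.2 - u.2).
  move=> Gu Gv; have := Glin (-1) _ _ Gu Gv.
  by rewrite /= scaleN1r mulN1r ![- _ + _]addrC.
have Gfun x r r' : G (x, r) -> G (x, r') -> r <= r'.
  move=> Gr Gr'; have := Gq _ (GB _ _ Gr' Gr).
  by rewrite /= subrr -(scale0r (0 : E)) qZ normr0 mul0r subr_le0.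
have Gtot x : exists r, G (x, r).
  apply: contrapT => nGx.
  (* One-dimensional extension: the value at [x] must lie above all of [A] and below every
     [q (v.1 + x) - v.2]; [sepP] says that these two families are separated. *)
  pose A := [set u.2 - q (u.1 - x) | u in G]; pose c := sup A.
  have sepP u v : G u -> G v -> u.2 - q (u.1 - x) <= q (v.1 + x) - v.2.
    move=> Gu Gv; rewrite lerBlDr addrAC lerBrDr.
    have := Glin 1 _ _ Gu Gv; rewrite scale1r mul1r => /Gq /= /le_trans; apply.
    have -> : u.1 + v.1 = v.1 + x + (u.1 - x) by rewrite addrACA subrr addr0 addrC.
    exact: qD.
  have A0 : A !=set0 by exists (0 - q (0 - x)), (0, 0).
  have Aub : has_sup A.
    by split=> //; exists (q (0 + x) - 0) => _ [u Gu <-]; exact: (sepP u _ Gu G0).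
  have cl u : G u -> u.2 - q (u.1 - x) <= c.
    by move=> Gu; apply: sup_upper_bound => //; exists u.
  have cr v : G v -> c <= q (v.1 + x) - v.2.
    by move=> Gv; apply: ge_sup => // _ [u Gu <-]; exact: sepP.
  pose g' := [set u : E * R | exists v (t : R), G v /\
      u = (v.1 + t *: x, v.2 + t * c)].
  have Gg' : G `<=` g'.
    by move=> [y r] Gy; exists (y, r), 0; rewrite scale0r mul0r !addr0.
  have g'd : dominated g'.
    split=> [a _ _ [u [t [Gu ->]]] [v [t' [Gv ->]]] /=|_ [u [t [Gu ->]]] /=].
      exists (a *: u.1 + v.1, a * u.2 + v.2), (a * t + t').
      split; first exact: Glin.
      congr pair => /=; last by ring.
      by rewrite scalerDr scalerA scalerDl addrACA.
    have [->|t0] := eqVneq t 0; first by rewrite scale0r mul0r !addr0; exact: Gq.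
    have ta : 0 < `|t| by rewrite normr_gt0.
    (* Dividing by the absolute value of [t] leaves only the coefficients 1 and -1 of [x], which
       [cr] and [cl] settle. *)
    suff : `|t|^-1 * (u.2 + t * c) <= q (`|t|^-1 *: (u.1 + t *: x)).
      by rewrite qZ normfV normr_id ler_pM2l ?invr_gt0.
    have Gu' := GZ (`|t|^-1) _ Gu.
    rewrite mulrDr scalerDr mulrA scalerA.
    have [tp|tn] := ltP 0 t.
      have -> : `|t|^-1 * t = 1 by rewrite gtr0_norm// mulVf.
      have /= := cr _ Gu'; rewrite scale1r mul1r; lra.
    have -> : `|t|^-1 * t = -1 by rewrite ler0_norm// invrN mulNr mulVf.
    have /= := cl _ Gu'; rewrite scaleN1r mulN1r; lra.
  apply: (gmax g'); last first.
    rewrite /P setUidl//; apply: subset_trans Gg'; exact: subsetUr.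
  split; first by move=> u gu; apply: Gg'; left.
  move=> g'g; apply: nGx; exists c; left; apply: g'g.
  by exists (0, 0), 1; rewrite scale1r mul1r !add0r.
have [f fG] := choice Gtot; exists f.
have fE x r : G (x, r) -> f x = r.
  by move=> Gr; apply/eqP; rewrite eq_le; apply/andP; split;
    [exact: Gfun (fG x) Gr|exact: Gfun Gr (fG x)].
split=> [a x y|x|]; first by apply: fE; exact: (Glin a _ _ (fG x) (fG y)).
  exact: (Gq _ (fG x)).
by apply: fE; right; exists 1; rewrite scale1r mul1r.
Qed.

End HahnBanach.

(** * Finite-dimensional subspaces *)

Section Spans.
Context {R : realType} {X : lmodType R}.
Implicit Types (s b : seq X) (V : set X).

Lemma span_consP x s v : span_of (x :: s) v <->
  exists (t : R) w, span_of s w /\ v = t *: x + w.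
Proof.
split=> [[a ->]|[t [w [[a ->] ->]]]].
  exists (a ord0), (\sum_(k < size s) a (lift ord0 k) *: s`_k).
  by split; [exists (fun k => a (lift ord0 k))|rewrite big_ord_recl].
exists (fun k => oapp a t (unlift ord0 k)); rewrite big_ord_recl unlift_none.
by congr (_ + _); apply: eq_bigr => k _; rewrite liftK.
Qed.

Lemma span_subspace s : is_subspace (span_of s).
Proof.
split; first by exists (fun=> 0); rewrite big1// => k _; rewrite scale0r.
move=> t _ _ [a ->] [a' ->]; exists (fun k => t * a k + a' k).
rewrite scaler_sumr -big_split; apply: eq_bigr => k _.
by rewrite scalerDl scalerA.
Qed.

Lemma mem_span s x : x \in s -> span_of s x.
Proof.
elim: s => [//|y s IH]; rewrite inE => /orP[/eqP ->|/IH xs]; apply/span_consP.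
  by exists 1, 0; split; [case: (span_subspace s)|rewrite scale1r addr0].
by exists 0, x; rewrite scale0r add0r.
Qed.

Lemma span_min s V : is_subspace V -> (forall x, x \in s -> V x) ->
  span_of s `<=` V.
Proof.
move=> VS sV _ [a ->]; apply: subspace_sum => // k _; apply: subspaceZ => //.
by apply: sV; rewrite mem_nth.
Qed.

(** Independence of the images of [b] in the quotient by [V]. Taking [V = [set 0]] gives bases;
    taking [V = Y] gives a complement, inside a span, of its intersection with [Y]. *)
Definition indep_mod V b := forall a : 'I_(size b) -> R,
  V (\sum_(k < size b) a k *: b`_k) -> forall k, a k = 0.

(** By induction on [s], the new vector joins [b] unless it already lies in the span of [b] modulo
    [V]. *)
Lemma indep_mod_exists V s : is_subspace V -> exists b,
  [/\ indep_mod V b, span_of b `<=` span_of s &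
      forall v, span_of s v -> exists2 w, span_of b w & V (v - w)].
Proof.
move=> VS; elim: s => [|x s [b [bV bs sb]]].
  exists [::]; split=> //; first by move=> a _ [].
  by move=> v sv; exists v => //; rewrite subrr; case: VS.
have ssx : span_of s `<=` span_of (x :: s).
  apply: span_min; first exact: span_subspace.
  by move=> y ys; apply: mem_span; rewrite inE ys orbT.
have [[w bw Vxw]|nx] := pselect (exists2 w, span_of b w & V (x - w)).
  exists b; split=> //; first exact: subset_trans ssx.
  move=> _ /span_consP[t [v [/sb[u bu Vvu] ->]]].
  exists (t *: w + u); first by case: (span_subspace b) => _; apply.
  by rewrite opprD addrACA -scalerBr; case: VS => _; apply.
exists (x :: b); split.
- move=> a; rewrite big_ord_recl /= => Va.
  have a0 : a ord0 = 0.
    apply/eqP/negPn/negP => a0; apply: nx.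
    exists (- (a ord0)^-1 *: \sum_(k < size b) a (lift ord0 k) *: b`_k).
      apply: subspaceZ; first exact: span_subspace.
      by exists (fun k => a (lift ord0 k)).
    rewrite scaleNr opprK -[x in x + _]scale1r -(mulVf a0) -scalerA -scalerDr.
    exact: subspaceZ.
  move: Va; rewrite a0 scale0r add0r => /(bV (fun k => a (lift ord0 k))) ak k.
  by case: (unliftP ord0 k) => [j ->|->].
- apply: span_min; first exact: span_subspace.
  move=> y; rewrite inE => /orP[/eqP ->|yb].
    by apply: mem_span; rewrite inE eqxx.
  by apply: ssx; apply: bs; exact: mem_span.
- move=> _ /span_consP[t [v [/sb[u bu Vvu] ->]]].
  exists (t *: x + u); first by apply/span_consP; exists t, u.
  by rewrite opprD addrACA subrr add0r.
Qed.

Lemma basis_exists s : exists2 b, indep_mod [set 0] b & span_of b = span_of s.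
Proof.
have [|b [b0 bs sb]] := @indep_mod_exists [set 0] s.
  by split=> // a _ _ -> ->; rewrite scaler0 addr0.
exists b => //; apply/seteqP; split=> // v /sb[w bw /subr0_eq ->//].
Qed.

End Spans.

(** * Norm equivalence, compactness and nets in finite dimension *)

Section FiniteDimension.
Context {R : realType} {X : normedModType R}.
Implicit Types (s b : seq X).

Let comb b (c : 'rV[R]_(size b)) : X := \sum_(k < size b) c ord0 k *: b`_k.

Let comb_continuous b : continuous (@comb b).
Proof.
rewrite /comb; elim: (index_enum _) => [|k r IH].
  by under eq_fun do rewrite big_nil; exact: cst_continuous.
under eq_fun do rewrite big_cons.
move=> c; apply: (@cvgD _ _ _ (nbhs c)); last exact: IH.
apply: (@cvgZ _ _ _ (nbhs c) _ (fun c : 'rV_(size b) => c ord0 k)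
  (fun=> b`_k)); [exact: coord_continuous|exact: cvg_cst].
Qed.

Let comb_norm_continuous b : continuous (fun c => `|@comb b c|).
Proof.
by move=> c; apply: (@cvg_norm _ _ _ (nbhs c)); exact: comb_continuous.
Qed.

Let comb_span b c : span_of b (@comb b c).
Proof. by exists (fun k => c ord0 k). Qed.

Let coord_le n (c : 'rV[R]_n) k : `|c ord0 k| <= `|c|.
Proof.
rewrite [leRHS]/Num.norm/= mx_normrE.
by apply/bigmax_geP; right => /=; exists (ord0, k).
Qed.

(** The norm of [comb] attains a minimum on the compact unit sphere of coordinate rows; independence
    makes it positive, and [C] is its inverse. *)
Lemma indep_norm b : indep_mod [set 0] b -> exists2 C : R, 0 <= C &
  forall a k, `|a k| <= C * `|\sum_(k < size b) a k *: b`_k|.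
Proof.
move=> b0; pose S := [set c : 'rV[R]_(size b) | `|c| = 1].
have combZ t c : comb (t *: c) = t *: @comb b c.
  by rewrite scaler_sumr; apply: eq_bigr => k _; rewrite mxE scalerA.
have combE (a : 'I_(size b) -> R) : comb (\row_k a k) = \sum_(k < size b) a k *: b`_k.
  by apply: eq_bigr => k _; rewrite mxE.
have comb0 c : @comb b c = 0 -> c = 0.
  by move=> /b0 c0; apply/rowP => k; rewrite c0 mxE.
(* The sphere is empty for the empty list, where no minimum is available. *)
have [S0|/set0P S0] := eqVneq S set0.
  exists 0 => // a k; rewrite mul0r.
  have [c0|c0] := eqVneq (\row_k a k : 'rV[R]_(size b)) 0.
    have := congr1 (fun c : 'rV[R]_(size b) => c ord0 k) c0.
    by rewrite !mxE => ->; rewrite normr0.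
  have : S (`|\row_k a k : 'rV[R]_(size b)|^-1 *: \row_k a k).
    by rewrite /S/= normrZ normfV normr_id mulVf// normr_eq0.
  by rewrite S0.
have Sc : compact S.
  apply: bounded_closed_compact.
    by exists 1; split=> // M M1 c; rewrite /S/= => ->; exact: ltW.
  rewrite (_ : S = Num.norm @^-1` [set (1 : R)]) //.
  apply: preimage_closed; first by move=> c _; exact: norm_continuous.
  exact: closed_eq.
have [|c0] := @EVT_min_rV R (size b) (fun c => `|comb c|) S S0 Sc.
  apply: continuous_subspaceT => c.
  by exact: comb_norm_continuous.
rewrite inE => Sc0 minc.
have m0 : 0 < `|comb c0|.
  rewrite normr_gt0; apply/eqP => /comb0 c00.
  by move: Sc0; rewrite /S /= c00 normr0 => /eqP; rewrite eq_sym oner_eq0.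
exists (`|comb c0|^-1); first by rewrite invr_ge0.
move=> a k; rewrite -combE; set c := \row_k a k.
have -> : a k = c ord0 k by rewrite mxE.
apply: (le_trans (coord_le _ _)); rewrite ler_pdivlMl//.
have [->|cn0] := eqVneq c 0; first by rewrite normr0 mulr0.
have cp : 0 < `|c| by rewrite normr_gt0.
rewrite -ler_pdivlMr// [leRHS]mulrC.
have -> : `|c|^-1 * `|comb c| = `|comb (`|c|^-1 *: c)|.
  by rewrite combZ normrZ normfV normr_id.
by apply: minc; rewrite inE /S/= normrZ normfV normr_id mulVf// gt_eqF.
Qed.

Lemma span_ball_compact s r : compact [set v | span_of s v /\ `|v| <= r].
Proof.
have [b b0 <-] := basis_exists s.
have [C C0 bC] := indep_norm b0.
pose K := [set c : 'rV[R]_(size b) | `|comb c| <= r].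
have -> : [set v | span_of b v /\ `|v| <= r] = @comb b @` K.
  apply/seteqP; split=> [_ [[a ->] ar]|_ [c cr <-]]; last first.
    by split=> //; exact: comb_span.
  have cE : comb (\row_k a k) = \sum_(k < size b) a k *: b`_k.
    by apply: eq_bigr => k _; rewrite mxE.
  by exists (\row_k a k) => //; rewrite /K/= cE.
apply: continuous_compact.
  by apply: continuous_subspaceT => c; exact: (@comb_continuous b c).
apply: bounded_closed_compact.
  exists `|C * r|; split=> // M rM c cr /=; apply: le_trans (ltW rM).
  rewrite [leLHS]/Num.norm/= mx_normrE; apply/bigmax_leP; split=> // -[i k] _ /=.
  rewrite ord1; apply: (le_trans (bC (fun k => c ord0 k) k)).
  by apply: le_trans (ler_norm _); rewrite ler_wpM2l.
rewrite (_ : K = (fun c => `|comb c|) @^-1` [set t | t <= r]) //.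
apply: preimage_closed; last exact: closed_le.
by move=> c _; exact: comb_norm_continuous.
Qed.

(** Closedness is local: near [v] only the part of the span of norm at most [|v| + 1] matters, and
    that part is compact. *)
Lemma span_closed s : closed (span_of s).
Proof.
move=> v clv; pose B := [set w | span_of s w /\ `|w| <= `|v| + 1].
suff [] : B v by [].
have : closed B.
  by apply: compact_closed; [exact: norm_hausdorff|exact: span_ball_compact].
apply=> A Av; have [] := clv (A `&` ball v 1).
  by apply: filterI => //; exact: nbhsx_ballx.
move=> w [sw [Aw]]; rewrite -ball_normE /= => vw.
exists w; split=> //; split=> //.
rewrite -[w in leLHS](subrK v) addrC (le_trans (ler_normD _ _))// lerD2l distrC.
exact: ltW.
Qed.

Lemma span_net s (d : R) : 0 < d -> exists m (u : 'I_m -> X),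
  (forall j, span_of s (u j) /\ `|u j| <= 1) /\
  forall v, span_of s v -> `|v| <= 1 -> exists j, `|v - u j| < d.
Proof.
move=> d0; have := @span_ball_compact s 1; rewrite compact_cover.
set B := [set v | _] => /(_ X B (fun u => ball u d)) [].
- by move=> u _; exact: ball_open.
- by move=> u Bu; exists u => //; exact: ballxx.
move=> D DB BD; pose D' := finmap.enum_fset D.
exists (size D'), (fun j => nth 0 D' j); split=> [j|v sv v1].
  by apply: set_mem; apply: DB; exact: mem_nth.
have [u uD] := BD v (conj sv v1); rewrite -ball_normE /= distrC => uv.
have uD' : (index u D' < size D')%N by rewrite index_mem.
by exists (Ordinal uD') => /=; rewrite nth_index.
Qed.

Lemma span_linear_bounded (F : normedModType R) s (T : X -> F) :
  (forall (a : R) u v, span_of s u -> span_of s v ->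
     T (a *: u + v) = a *: T u + T v) ->
  exists2 C : R, 0 <= C & forall v, span_of s v -> `|T v| <= C * `|v|.
Proof.
have [b b0 <-] := basis_exists s => Tl; have [C C0 bC] := indep_norm b0.
exists (\sum_(k < size b) C * `|T b`_k|).
  by apply: sumr_ge0 => k _; rewrite mulr_ge0.
move=> _ [a ->]; set v := \sum_(k < _) _.
rewrite /v (linear_on_sum (span_subspace b) Tl); last first.
  by move=> k; apply: mem_span; exact: mem_nth.
rewrite mulr_suml; apply: (le_trans (ler_norm_sum _ _ _)).
by apply: ler_sum => k _; rewrite normrZ mulrAC ler_wpM2r// bC.
Qed.

End FiniteDimension.

(** * Local reflexivity *)

Section SupDistance.
Context {R : realType} {X : normedModType R} {m : nat}.
Implicit Types z w : 'I_m -> X.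

Let single (j : 'I_m) (x : X) : 'I_m -> X := fun i => if i == j then x else 0.

Let sum_single z : z = \sum_j single j (z j).
Proof.
apply/funext => i; rewrite fct_sumE (bigD1 i)//= /single eqxx big1 ?addr0//.
by move=> j /negbTE ji; rewrite eq_sym ji.
Qed.

(** Hahn-Banach is applied to the seminorm [q], the sup-norm distance to [K]: a functional below [q]
    vanishes on [K] and has norm at most 1, and it is chosen to attain [q w]. The [phi j] are its
    components. The slack [e] is there because the distance need not be attained. *)
Lemma sup_dist_duality (K : set ('I_m -> X)) w : is_subspace K ->
  exists phi : 'I_m -> X -> R,
  [/\ forall j (a : R) x y, phi j (a *: x + y) = a * phi j x + phi j y,
      forall z, (forall j, `|z j| <= 1) -> \sum_j phi j (z j) <= 1,
      forall k, K k -> \sum_j phi j (k j) = 0 &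
      forall e, 0 < e -> exists2 k, K k &
        forall j, `|w j - k j| <= \sum_j phi j (w j) + e].
Proof.
(* The clause [0 <= M] matters for [m = 0], where every real number bounds the empty family. *)
move=> KS; pose Q z := [set M : R | 0 <= M /\
  exists2 k, K k & forall j, `|z j - k j| <= M].
have Qn z : Q z !=set0.
  exists (\sum_j `|z j|); split; first by apply: sumr_ge0.
  exists 0; first by case: KS.
  by move=> j; rewrite subr0 (bigD1 j)//= lerDl sumr_ge0.
have Ql z : has_lbound (Q z) by exists 0 => M [].
pose q z := inf (Q z).
have q_le z M : Q z M -> q z <= M by exact: ge_inf.
have q_ge z c : (forall M, Q z M -> c <= M) -> c <= q z.
  by move=> cM; exact: lb_le_inf.
have qD x y : q (x + y) <= q x + q y.
  rewrite -lerBlDr; apply: (q_ge _ _) => M [M0 [k Kk kM]].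
  rewrite lerBlDr [M + _]addrC -lerBlDr; apply: q_ge => N [N0 [l Kl lN]].
  rewrite lerBlDr; apply: q_le; split; first exact: addr_ge0.
  exists (l + k) => [|j]; first exact: subspaceD.
  by rewrite !fctE [x j + _]addrC opprD addrACA (le_trans (ler_normD _ _))// lerD.
have qZ_le (a : R) x : a != 0 -> q (a *: x) <= `|a| * q x.
  move=> a0; rewrite -ler_pdivrMl ?normr_gt0//; apply: q_ge => M [M0 [k Kk kM]].
  rewrite ler_pdivrMl ?normr_gt0//; apply: q_le; split; first by rewrite mulr_ge0.
  exists (a *: k) => [|j]; first exact: subspaceZ.
  by rewrite !fctE -scalerBr normrZ ler_wpM2l.
have q_ge0 x : 0 <= q x by apply: q_ge => M [].
have qK k : K k -> q k = 0.
  move=> Kk; apply/eqP; rewrite eq_le q_ge0 andbT; apply: q_le; split=> //.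
  by exists k => // j; rewrite subrr normr0.
have qZ (a : R) x : q (a *: x) = `|a| * q x.
  have [->|a0] := eqVneq a 0.
    by rewrite scale0r normr0 mul0r qK//; case: KS.
  apply/eqP; rewrite eq_le qZ_le//=.
  rewrite -ler_pdivlMl ?normr_gt0// -normfV.
  have := @qZ_le a^-1 (a *: x); rewrite scalerA mulVf// scale1r; apply.
  by rewrite invr_eq0.
have [f [fl fq fw]] := hahn_banach qD qZ w.
have f0 : f 0 = 0 by have := fl (-1) 0 0; rewrite scaler0 addr0 mulN1r addNr.
have fD : {morph f : x y / x + y >-> x + y}.
  by move=> x y; have := fl 1 x y; rewrite scale1r mul1r.
have fsum z : f z = \sum_j f (single j (z j)).
  by rewrite [in LHS](sum_single z) (big_morph f fD f0).
exists (fun j x => f (single j x)); split.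
- move=> j a x y; rewrite -fl; congr f; apply/funext => i.
  by rewrite /single !fctE; case: ifP => // _; rewrite scaler0 addr0.
- move=> z z1; rewrite -fsum; apply: (le_trans (fq _)); apply: q_le; split=> //.
  by exists 0 => [|j]; [case: KS|rewrite subr0].
- move=> k Kk; rewrite -fsum; apply/eqP; rewrite eq_le.
  rewrite (le_trans (fq _)) ?qK//=.
  have := fq (- k); rewrite qK; last exact: subspaceN.
  have := fl (-1) k 0; rewrite addr0 scaleN1r f0 addr0 mulN1r => ->.
  by rewrite oppr_le0.
- move=> e e0; rewrite -fsum fw.
  have [|M [M0 [k Kk kM]] Mq] := @inf_adherent _ (Q w) e e0.
    by split; [exact: Qn|exact: Ql].
  by exists k => // j; apply: (le_trans (kM j)); exact: ltW.
Qed.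

End SupDistance.

Section OperatorNorm.
Context {R : realType} {X : normedModType R} (V : set X) (T : X -> X).
Hypotheses (VS : is_subspace V)
  (Tl : forall (a : R) u v, V u -> V v -> T (a *: u + v) = a *: T u + T v).

Lemma opnorm_le C : (forall v, V v -> `|v| <= 1 -> `|T v| <= C) ->
  opnorm_on V T <= C.
Proof.
move=> TC; apply: ge_sup; last by move=> _ [v [Vv v1] <-]; exact: TC.
by exists `|T 0|, 0 => //; split; [case: VS|rewrite normr0].
Qed.

(** The a priori bound [C] makes the supremum in [opnorm_on] a genuine one; on finite-dimensional
    spans it comes from [span_linear_bounded]. *)
Lemma opnorm_ge C v : 0 <= C -> (forall v, V v -> `|T v| <= C * `|v|) ->
  V v -> `|T v| <= opnorm_on V T * `|v|.
Proof.
move=> C0 TC Vv; have [->|v0] := eqVneq v 0.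
  by rewrite (linear_on0 VS Tl) !normr0 mulr0.
have vp : 0 < `|v| by rewrite normr_gt0.
rewrite -ler_pdivrMr//.
have -> : `|T v| / `|v| = `|T (`|v|^-1 *: v)|.
  by rewrite (linear_onZ VS Tl)// normrZ normfV normr_id mulrC.
apply: ub_le_sup.
  exists C => _ [u [Vu u1] <-]; apply: (le_trans (TC _ Vu)).
  by rewrite ler_piMr.
exists (`|v|^-1 *: v) => //; split; first exact: subspaceZ.
by rewrite normrZ normfV normr_id mulVf// normr_eq0.
Qed.

End OperatorNorm.

(** * From a linear map into the bidual to operators into [Y] *)

Section LocalReflexivity.
Context {R : realType} {X : normedModType R} (Y : set X) (lam : R)
  (H : X -> (X -> R) -> R).
Hypotheses (YS : is_subspace Y) (lam0 : 0 <= lam)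
  (Hdom : forall x, dual_dom (dual (subnsp Y)) (H x))
  (Hlin : forall phi, dual_dom (subnsp Y) phi ->
     forall (a : R) x x', H (a *: x + x') phi = a * H x phi + H x' phi)
  (Hnorm : forall x phi, dual_dom (subnsp Y) phi ->
     `|H x phi| <= lam * `|x| * dual_norm (subnsp Y) phi)
  (HY : forall y phi, Y y -> dual_dom (subnsp Y) phi -> H y phi = phi y).

Let YN : normed_nsp (subnsp Y). Proof. exact: normed_subnsp. Qed.

(** Unit vectors that nearly norm each functional can be chosen independently, with signs adjusted,
    and then tested together: a sup norm on families is dual to a sum of norms. *)
Let dual_norm_sum m (phi : 'I_m -> X -> R) :
  (forall j, dual_dom (subnsp Y) (phi j)) ->
  (forall z, (forall j, Y (z j) /\ `|z j| <= 1) -> \sum_j phi j (z j) <= 1) ->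
  \sum_j dual_norm (subnsp Y) (phi j) <= 1.
Proof.
move=> phiY phi1; apply/ler_addgt0Pl => e e0.
(* The divisor [m.+1] instead of [m] covers the empty family. *)
have e'0 : 0 < e / m.+1%:R by rewrite divr_gt0.
have zP j : exists z, [/\ Y z, `|z| <= 1 &
    dual_norm (subnsp Y) (phi j) <= phi j z + e / m.+1%:R].
  have [_ [z [Yz z1] <-]] := sup_adherent e'0 (dual_norm_has_sup YN (phiY j)).
  rewrite -/(dual_norm _ _) => /ltW; rewrite lerBlDr => zj.
  have [p|n] := lerP 0 (phi j z); first by exists z; rewrite -(ger0_norm p).
  exists (- z); split; [exact: subspaceN|by rewrite normrN|].
  have -> : phi j (- z) = - phi j z.
    have := linear_onZ YS (dual_dom_lin (phiY j)) (-1) Yz.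
    by rewrite !scaleN1r.
  by rewrite -(ltr0_norm n).
have [z zj] := choice zP.
apply: (@le_trans _ _ (\sum_j (phi j (z j) + e / m.+1%:R))).
  by apply: ler_sum => j _; case: (zj j).
rewrite big_split/= sumr_const card_ord [e + 1]addrC lerD//.
  by apply: phi1 => j; case: (zj j).
rewrite -[_ *+ m]mulr_natr mulrAC ler_pdivrMr// (ler_wpM2l (ltW e0))// ler_nat.
exact: leqnSn.
Qed.

(** An operator fixing the vectors of [V] in [Y] may take arbitrary values in [Y] on a basis [b] of
    [V] modulo [Y], so its values at the net points range over [w - K]. If [psi] annihilates [K],
    its restrictions to [Y] satisfy one linear relation for each vector of [b]. Applying [H] to
    these relations replaces each [w j] by [u j] in the pairing, and [H] is bounded by [lam] at
    [u j]. *)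
Lemma local_reflexivity : loc_compl Y lam.
Proof.
move=> V [s ->] eps eps0.
have VS := span_subspace s.
have [b [bY bs sb]] := indep_mod_exists s YS; pose n := size b.
have coefP v : exists a : 'I_n -> R, span_of s v ->
    Y (v - \sum_(k < n) a k *: b`_k).
  have [sv|nsv] := pselect (span_of s v); last by exists (fun=> 0).
  by have [_ [a ->] Yva] := sb v sv; exists a.
have {coefP}[coef coefP] := choice coefP.
pose bsum v := \sum_(k < n) coef v k *: b`_k.
have bV (k : 'I_n) : span_of s b`_k by apply: bs; apply: mem_span; exact: mem_nth.
(* The coordinates were chosen pointwise; their uniqueness modulo [Y] is what makes them linear and
   zero on [Y]. *)
have coef_uniq v a : span_of s v -> Y (v - \sum_(k < n) a k *: b`_k) ->
    forall k, coef v k = a k.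
  move=> sv Ya k; apply/eqP; rewrite -subr_eq0; apply/eqP.
  apply: (bY (fun k => coef v k - a k)).
  under eq_bigr do rewrite scalerBl; rewrite sumrB.
  have -> : bsum v - \sum_(k < n) a k *: b`_k =
      (v - \sum_(k < n) a k *: b`_k) - (v - bsum v).
    by rewrite opprB [RHS]addrC addrA subrK.
  by apply: subspaceB => //; exact: coefP.
have coef_lin (a : R) u v k : span_of s u -> span_of s v ->
    coef (a *: u + v) k = a * coef u k + coef v k.
  move=> su sv; apply: (coef_uniq _ (fun k => a * coef u k + coef v k)).
    by case: VS => _; apply.
  under eq_bigr do rewrite scalerDl -scalerA.
  rewrite big_split/= -scaler_sumr opprD addrACA -scalerBr.
  by case: YS => _; apply; exact: coefP.
have coefY v k : span_of s v -> Y v -> coef v k = 0.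
  move=> sv Yv; apply: (coef_uniq _ (fun=> 0)) => //.
  by rewrite big1 ?subr0// => i _; rewrite scale0r.
(* Chosen so that [(lam + eps) * (1 - d) = lam + eps / 2], which absorbs the net error at the
   end. *)
pose d := eps / 2 / (lam + eps).
have le0 : 0 < lam + eps by rewrite ltr_wpDl.
have d0 : 0 < d by rewrite !divr_gt0.
have [m [u [uP unet]]] := span_net s d0.
have us j : span_of s (u j) by case: (uP j).
(* The operator sending the [k]-th vector of [b] to [- y k] takes the value [w j - L y j] at
   [u j]. *)
pose w j := u j - bsum (u j).
have wY j : Y (w j) by exact: coefP.
pose L (y : 'I_n -> X) : 'I_m -> X := fun j => \sum_(k < n) coef (u j) k *: y k.
pose K := [set z | exists2 y, (forall k, Y (y k)) & z = L y].
have KS : is_subspace K.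
  split.
    exists 0 => [k|]; first by case: YS.
    by apply/funext => j; rewrite /L big1// => k _; rewrite scaler0.
  move=> a _ _ [y Yy ->] [y' Yy' ->]; exists (a *: y + y').
    by move=> k; case: YS => _; apply.
  apply/funext => j; rewrite /L !fctE scaler_sumr -big_split.
  by apply: eq_bigr => k _; rewrite scalerDr !scalerA mulrC.
have [psi [psil psi1 psiK psiw]] := sup_dist_duality w KS.
have psi_le1 : \sum_j psi j (w j) <= lam.
  (* The restriction of [psi j] to [Y], cut off by zero to be the representative that [dual_dom]
     requires. *)
  pose phi j : X -> R := fun x => if `[< Y x >] then psi j x else 0.
  have phiE j x : Y x -> phi j x = psi j x by rewrite /phi => Yx; rewrite asboolT.
  have psi0 j : psi j 0 = 0.
    by have := psil j (-1) 0 0; rewrite scaler0 addr0 mulN1r addNr.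
  have psiZ j (a : R) x : psi j (a *: x) = a * psi j x.
    by rewrite -[_ *: x]addr0 psil psi0 addr0.
  have psi_single j x : `|x| <= 1 -> psi j x <= 1.
    move=> x1; have := psi1 (fun i => if i == j then x else 0).
    rewrite (bigD1 j)//= eqxx big1 ?addr0.
      by apply=> i; case: ifP => // _; rewrite normr0.
    by move=> i /negbTE ->.
  have psi_norm j x : psi j x <= `|x|.
    have [->|x0] := eqVneq x 0; first by rewrite psi0 normr0.
    rewrite -[leRHS]mulr1 -ler_pdivrMl ?normr_gt0// -psiZ; apply: psi_single.
    by rewrite normrZ normfV normr_id mulVf ?normr_eq0.
  have phiY j : dual_dom (subnsp Y) (phi j).
    split.
      move=> a x y /= Yx Yy.
      have Yaxy : Y (a *: x + y) by case: YS => _; apply.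
      by rewrite (phiE _ _ Yaxy) (phiE _ _ Yx) (phiE _ _ Yy) psil.
    split; last by move=> x nYx; rewrite /phi asboolF.
    exists 1 => x Yx; rewrite mul1r phiE// ler_norml psi_norm andbT.
    rewrite lerNl; apply: le_trans (_ : psi j (- x) <= _).
      by rewrite -scaleN1r psiZ mulN1r.
    by rewrite /= -normrN; exact: psi_norm.
  have phi_sum : \sum_j dual_norm (subnsp Y) (phi j) <= 1.
    apply: dual_norm_sum => // z z1.
    rewrite (eq_bigr (fun j => psi j (z j))); last first.
      by move=> j _; rewrite phiE//; case: (z1 j).
    by apply: psi1 => j; case: (z1 j).
  (* [psi] is tested on the families in [K] whose only nonzero entry of [y] is the [k]-th one. *)
  have phi0 k : \sum_j coef (u j) k *: phi j = 0.
    apply/funext => y; rewrite fct_sumE.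
    have [Yy|nYy] := pselect (Y y); last first.
      by apply: big1 => j _; rewrite fctE /phi asboolF// scaler0.
    have Ky : K (fun j => coef (u j) k *: y).
      exists (fun l => if l == k then y else 0).
        by move=> l; case: ifP => // _; case: YS.
      apply/funext => j; rewrite /L (bigD1 k)//= eqxx big1 ?addr0//.
      by move=> l /negbTE ->; rewrite scaler0.
    rewrite -[RHS](psiK _ Ky); apply: eq_bigr => j _.
    by rewrite fctE phiE// psiZ.
  have Hb0 k : \sum_j coef (u j) k * H b`_k (phi j) = 0.
    have DS := dual_dom_subspace (subnsp Y).
    have Hl := dual_dom_lin (Hdom b`_k).
    have := linear_on_sum DS Hl (index_enum _) (fun j => coef (u j) k) phiY.
    by rewrite phi0 => <-; exact: (linear_on0 DS Hl).
  have Hsplit j : H (u j) (phi j) =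
      psi j (w j) + \sum_(k < n) coef (u j) k * H b`_k (phi j).
    rewrite -[X in H X _](subrK (bsum (u j))) -/(w j).
    have Hl := Hlin (phiY j).
    have := Hl 1 (w j) (bsum (u j)); rewrite scale1r mul1r => ->.
    rewrite HY// phiE//; congr (_ + _).
    pose Hj : X -> R^o := fun x => H x (phi j).
    have TS : is_subspace [set: X] by [].
    exact: (@linear_on_sum _ _ _ _ Hj TS (fun a x x' _ _ => Hl a x x') _
      (index_enum _) (fun k => coef (u j) k) (fun k => b`_k)).
  have -> : \sum_j psi j (w j) = \sum_j H (u j) (phi j).
    under [RHS]eq_bigr do rewrite Hsplit.
    rewrite big_split/= exchange_big/= [X in _ + X]big1 ?addr0//.
  apply: (@le_trans _ _ (\sum_j lam * dual_norm (subnsp Y) (phi j))).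
    apply: ler_sum => j _; apply: (le_trans (ler_norm _)).
    apply: (le_trans (Hnorm _ (phiY j))); rewrite -mulrA ler_wpM2l//.
    rewrite ler_piMl//; last by case: (uP j).
    exact: dual_norm_ge0.
  by rewrite -mulr_sumr ler_piMr.
have e20 : 0 < eps / 2 by rewrite divr_gt0.
have [_ [y Yy ->] wy] := psiw (eps / 2) e20.
pose T v := v - bsum v - \sum_(k < n) coef v k *: y k.
have Tl (a : R) v v' : span_of s v -> span_of s v' ->
    T (a *: v + v') = a *: T v + T v'.
  move=> sv sv'; rewrite /T /bsum.
  under eq_bigr do rewrite coef_lin// scalerDl -scalerA.
  under [X in _ - _ - X]eq_bigr do rewrite coef_lin// scalerDl -scalerA.
  rewrite !big_split/= -!scaler_sumr !scalerBr !opprD.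
  by rewrite (addrACA (a *: v)) (addrACA (a *: v - _)).
exists T; split.
  move=> v sv; apply: subspaceB => //; first exact: coefP.
  by apply: subspace_sum => // k _; exact: subspaceZ.
split=> //; split.
  move=> v sv Yv; rewrite /T /bsum !big1 ?subr0// => k _;
    by rewrite coefY// scale0r.
have [C C0 TC] := span_linear_bounded Tl.
set N := opnorm_on _ _.
have TN v : span_of s v -> `|T v| <= N * `|v| by exact: (opnorm_ge VS Tl C0 TC).
have N0 : 0 <= N.
  apply: le_trans (_ : `|T 0| <= _); first exact: normr_ge0.
  apply: ub_le_sup; last by exists 0 => //; split; [case: VS|rewrite normr0].
  exists C => _ [v [sv v1] <-]; apply: (le_trans (TC _ sv)).
  by rewrite ler_piMr.
(* A self-improving estimate: [N] is finite by [TC], and moving [v] to a net point costs at most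
   [N * d], with [d < 1]. *)
have : N <= lam + eps / 2 + N * d.
  apply: opnorm_le => // v sv v1; have [j vj] := unet v sv v1.
  rewrite -[v in leLHS](subrK (u j)) (linear_onD Tl)//; last exact: subspaceB.
  rewrite addrC (le_trans (ler_normD _ _))//; apply: lerD.
    apply: (le_trans (wy j)); exact: lerD.
  apply: (le_trans (TN _ _)); first exact: subspaceB.
  by rewrite ler_wpM2l// ltW.
have -> : lam + eps / 2 = (lam + eps) * (1 - d).
  have dE : (lam + eps) * d = eps / 2 by rewrite /d mulrC divfK ?gt_eqF.
  by rewrite mulrBr mulr1 dE -addrA [X in _ = _ + (X - _)]splitr addrK.
have d1 : 0 < 1 - d.
  rewrite subr_gt0 /d ltr_pdivrMr// mul1r.
  by rewrite [ltRHS](_ : _ = lam + eps / 2 + eps / 2);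
    [rewrite ltrDr ltr_wpDl|rewrite -addrA -splitr].
by rewrite -lerBlDr -[X in X - _]mulr1 -mulrBr ler_pM2r.
Qed.

End LocalReflexivity.

(** * Linearization of Lipschitz maps *)

Section Linearization.
Context {R : realType} {X : normedModType R}.

(** The defect [E] is additive and vanishes at 1, hence has period 1 on the nonnegative reals and is
    bounded there by its bound on the unit interval. Multiples [E (t *+ n) = E t *+ n] stay bounded
    only if [E t = 0]. *)
Lemma additive_bounded_homogeneous (F : X -> R) C :
  (forall x y, F (x + y) = F x + F y) -> (forall x, `|F x| <= C * `|x|) ->
  forall (a : R) x, F (a *: x) = a * F x.
Proof.
move=> FD FC a x; pose E (t : R) := F (t *: x) - t * F x.
suff /eqP : E a = 0 by rewrite subr_eq0 => /eqP.
have ED s t : E (s + t) = E s + E t.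
  by rewrite /E scalerDl FD mulrDl opprD addrACA.
have E0 : E 0 = 0 by apply: (addIr (E 0)); rewrite -ED !add0r.
have EN t : E (- t) = - E t by apply/eqP; rewrite -addr_eq0 -ED addNr E0.
have EMn n t : E (t *+ n) = E t *+ n.
  by elim: n => [|n IH]; rewrite ?mulr0n// !mulrS ED IH.
have E1 : E 1 = 0 by rewrite /E scale1r mul1r subrr.
pose K := C * `|x| + `|F x|.
have EK t : `|E t| <= K * `|t|.
  rewrite /E (le_trans (ler_normB _ _))// /K mulrDl normrM [`|F x| * _]mulrC lerD//.
  by apply: (le_trans (FC _)); rewrite normrZ mulrCA mulrC.
have K0 : 0 <= K by have := EK 1; rewrite normr1 mulr1; exact: le_trans.
have Epos t : 0 <= t -> `|E t| <= K.
  move=> t0; have /andP[tn nt] := truncn_itv t0.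
  rewrite -[t](subrK (Num.truncn t)%:R) ED EMn E1 mul0rn addr0.
  apply: (le_trans (EK _)); rewrite ler_piMr// ger0_norm ?subr_ge0//.
  by rewrite lerBlDr addrC natr1 ltW.
have Epos0 t : 0 <= t -> E t = 0.
  move=> t0; apply/eqP/negPn/negP; rewrite -normr_gt0 => Et.
  pose n := (Num.truncn (K / `|E t|)).+1.
  have := Epos _ (mulrn_wge0 n t0); rewrite EMn normrMn leNgt => /negP; apply.
  by rewrite -mulr_natl -ltr_pdivrMr// truncnS_gt.
have [/Epos0//|/ltW] := lerP 0 a.
by rewrite -oppr_ge0 => /Epos0; rewrite EN => /eqP; rewrite oppr_eq0 => /eqP.
Qed.

Variables (Y : set X) (lam : R) (h : X -> (X -> R) -> R).
Hypotheses (YS : is_subspace Y) (lam0 : 0 <= lam)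
  (hdom : forall x, dual_dom (dual (subnsp Y)) (h x))
  (hlip : forall x x',
    dual_norm (dual (subnsp Y)) (h x - h x') <= lam * `|x - x'|)
  (hY : forall y, Y y -> h y = canj Y y).

(* Averaging the increments [h (z + x + y) - h (z + y)] over [y] in [Y] and then
   over [z] in [X] with invariant means keeps the Lipschitz bound and makes the
   dependence on [x] additive; the inner mean preserves the values on [Y]. *)
Lemma lipschitz_bidual_loc_compl : loc_compl Y lam.
Proof.
have YN : normed_nsp (subnsp Y) by exact: normed_subnsp.
have YDN := normed_dual YN.
have [mX [mXl mXb mXc mXi]] := @invariant_mean R X setT I (fun _ _ _ _ => I).
have YD x y : Y x -> Y y -> Y (x + y) by exact: subspaceD.
have [mY [mYl mYb mYc mYi]] := @invariant_mean R X Y (proj1 YS) YD.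
have mYeq f g : bdd_on Y f -> bdd_on Y g -> (forall y, Y y -> f y = g y) ->
    mY f = mY g.
  move=> fb gb fg; apply/eqP; rewrite -subr_eq0 -normr_le0.
  rewrite addrC -mulN1r -mYl//; apply: mYb => y Yy.
  by rewrite mulN1r fg// addNr normr0.
pose B (x : X) (phi : X -> R) := lam * `|x| * dual_norm (subnsp Y) phi.
have hL x x' phi : dual_dom (subnsp Y) phi ->
    `|h x phi - h x' phi| <= lam * `|x - x'| * dual_norm (subnsp Y) phi.
  move=> phiY; have hB : dual_dom (dual (subnsp Y)) (h x - h x').
    by apply: subspaceB => //; exact: dual_dom_subspace.
  apply: (le_trans (dual_norm_ge YDN hB phiY)); rewrite ler_wpM2r//.
  exact: dual_norm_ge0.
pose D x phi z y := h (z + x + y) phi - h (z + y) phi.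
have DB x phi z y : dual_dom (subnsp Y) phi -> `|D x phi z y| <= B x phi.
  move=> phiY; apply: (le_trans (hL _ _ _ phiY)).
  by rewrite [z + x + y]addrAC [z + y + x]addrC addrK.
have Dbdd x phi z : dual_dom (subnsp Y) phi -> bdd_on Y (D x phi z).
  by move=> phiY; exists (B x phi) => y _; exact: DB.
have mYD x phi z : dual_dom (subnsp Y) phi -> `|mY (D x phi z)| <= B x phi.
  by move=> phiY; apply: mYb => y _; exact: DB.
have mYDbdd x phi : dual_dom (subnsp Y) phi ->
    bdd_on setT (fun z => mY (D x phi z)).
  by move=> phiY; exists (B x phi) => z _; exact: mYD.
pose H x phi := if `[< dual_dom (subnsp Y) phi >]
  then mX (fun z => mY (D x phi z)) else 0.
have HE x phi : dual_dom (subnsp Y) phi ->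
    H x phi = mX (fun z => mY (D x phi z)).
  by move=> phiY; rewrite /H asboolT.
have Hnorm x phi : dual_dom (subnsp Y) phi -> `|H x phi| <= B x phi.
  by move=> phiY; rewrite HE//; apply: mXb => z _; exact: mYD.
have DS := dual_dom_subspace (subnsp Y).
apply: (@local_reflexivity _ _ _ _ H) => //.
- move=> x; split.
    move=> a phi psi phiY psiY.
    have apY : dual_dom (subnsp Y) (a *: phi + psi) by case: DS => _; apply.
    rewrite !HE// -mXl; [|exact: mYDbdd..].
    congr mX; apply/funext => z; rewrite -mYl; [|exact: Dbdd..].
    congr mY; apply/funext => y.
    have hl w := dual_dom_lin (hdom w) a phiY psiY.
    rewrite /D !hl /GRing.scale/=; ring.
  split; last by move=> phi nphi; rewrite /H asboolF.
  by exists (lam * `|x|) => phi phiY; exact: Hnorm.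
- move=> phi phiY; have HD x x' : H (x + x') phi = H x phi + H x' phi.
    rewrite !HE//.
    (* The increment [D (x + x') phi z] splits as [D x phi (z + x')] plus [D x' phi z], and [mX]
       ignores the shift by [x']. *)
    have <- : mX (fun z => mY (D x phi (z + x'))) = mX (fun z => mY (D x phi z)).
      by apply: (mXi (fun z => mY (D x phi z))) => //; exact: mYDbdd.
    rewrite -[X in _ = X + _]mul1r -mXl; last exact: mYDbdd.
      congr mX; apply/funext => z; rewrite -mYl; [|exact: Dbdd..].
      congr mY; apply/funext => y; rewrite mul1r /D [x + x']addrC addrA.
      by rewrite addrA subrK.
    by have [C CB] := mYDbdd x phi phiY; exists C => z _; exact: CB.
  move=> a x x'; rewrite HD; congr (_ + _).
  apply: (@additive_bounded_homogeneous (H^~ phi)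
    (lam * dual_norm (subnsp Y) phi)) => // w.
  by apply: (le_trans (Hnorm _ _ phiY)); rewrite /B mulrAC.
- move=> y0 phi Yy0 phiY; rewrite HE// -[RHS]mXc; congr mX; apply/funext => z.
  have hphi y : Y y -> h y phi = phi y.
    by move=> Yy; rewrite hY// /canj asboolT.
  (* On [Y] the map [h] is the canonical embedding, so the Lipschitz bound keeps [g] bounded there
     although its two terms may not be. The increment along [y0] is that of [g], which has mean 0,
     plus the constant [phi y0]. *)
  pose g y := h (z + y) phi - phi y.
  have gb : bdd_on Y g.
    exists (lam * `|z| * dual_norm (subnsp Y) phi) => y Yy; rewrite /g -hphi//.
    by apply: (le_trans (hL _ _ _ phiY)); rewrite addrK.
  have gb' : bdd_on Y (fun y => g (y + y0)).
    by have [C CB] := gb; exists C => y Yy; apply: CB; exact: YD.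
  have cb : bdd_on Y (fun=> phi y0) by exists `|phi y0|.
  have ggb : bdd_on Y (fun y => 1 * g (y + y0) + phi y0).
    have [C CB] := gb'; exists (C + `|phi y0|) => y Yy.
    by rewrite mul1r (le_trans (ler_normD _ _))// lerD// CB.
  have gggb : bdd_on Y (fun y => -1 * g y + (1 * g (y + y0) + phi y0)).
    have [C CB] := ggb; have [C' CB'] := gb; exists (C' + C) => y Yy.
    by rewrite mulN1r (le_trans (ler_normD _ _))// normrN lerD// ?CB ?CB'.
  rewrite (mYeq _ (fun y => -1 * g y + (1 * g (y + y0) + phi y0)))//.
  + rewrite mYl// mYl// mYi// mYc; ring.
  + exact: Dbdd.
  + move=> y Yy; have phiD : phi (y + y0) = phi y + phi y0.
      exact: (linear_onD (dual_dom_lin phiY) Yy Yy0).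
    rewrite /D /g phiD.
    have -> : z + (y + y0) = z + y0 + y by rewrite [y + y0]addrC addrA.
    ring.
Qed.

End Linearization.

(** * Banach spaces carried by subsets *)

Section BanachNsp.
Context {R : realType}.

(** Completeness is stated for arbitrary indexed filters rather than sequences, so that it can be
    applied to a Cauchy filter on the type built from [s], indexed by that type itself. *)
Definition banach_nsp (s : nsp R) : Prop :=
  [/\ normed_nsp s, forall x, ndom s x -> nnorm s x = 0 -> x = 0 &
    forall (I : Type) (F : set_system I) (f : I -> nT s), ProperFilter F ->
      (forall i, ndom s (f i)) ->
      (forall e : R, 0 < e -> exists2 A, F A &
         forall i j, A i -> A j -> nnorm s (f i - f j) <= e) ->
      exists2 x, ndom s x &
        forall e : R, 0 < e -> \forall i \near F, nnorm s (f i - x) <= e].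

Lemma banach_subnsp (X : completeNormedModType R) (V : set X) :
  is_subspace V -> closed V -> banach_nsp (subnsp V).
Proof.
move=> VS Vc; split; first exact: normed_subnsp.
  by move=> x _ /eqP; rewrite normr_eq0 => /eqP.
move=> I F f FF Vf fC.
have fcvg : cvg (f @ F).
  apply: cauchy_cvg; apply/cauchyP => e e0.
  have e20 : 0 < e / 2 by rewrite divr_gt0.
  have [A FA Ae] := fC _ e20.
  have [i Ai] := filter_ex FA; exists (f i).
  apply: (@filterS _ F _ A _ _ FA) => j Aj /=; rewrite -ball_normE /=.
  have /= fij := Ae i j Ai Aj; apply: le_lt_trans fij _.
  by rewrite ltr_pdivrMr// ltr_pMr// ltr1n.
exists (lim (f @ F)).
  apply: (closed_cvg V Vc _ _ fcvg); apply: nearW => i; exact: Vf.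
move=> e e0; have /cvgrPdist_le/(_ e e0) : f @ F --> lim (f @ F) by [].
by apply: filterS => i; rewrite distrC.
Qed.

Lemma banach_dual (s : nsp R) : normed_nsp s -> banach_nsp (dual s).
Proof.
move=> sN; have DN := normed_dual sN; have [sS _ _] := sN.
have DS := dual_dom_subspace s.
split=> //.
  move=> phi sphi /= phi0; apply/funext => x.
  have [sx|nsx] := pselect (ndom s x); last by case: sphi => _ [_ ->].
  by have := dual_norm_ge sN sphi sx; rewrite phi0 mul0r normr_le0 => /eqP.
move=> I F f FF sf fC.
have fcvg x : ndom s x -> cvg (f i x @[i --> F]).
  move=> sx; apply: cauchy_cvg; apply/cauchyP => e e0.
  have x0 : 0 < nnorm s x + 1 by rewrite ltr_wpDl// nnorm_ge0.
  have ex0 : 0 < e / (nnorm s x + 1) by rewrite divr_gt0.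
  have [A FA Ae] := fC _ ex0.
  have [i Ai] := filter_ex FA; exists (f i x).
  apply: (@filterS _ F _ A _ _ FA) => j Aj /=; rewrite -ball_normE /=.
  apply: (le_lt_trans (dual_norm_ge sN (subspaceB DS (sf i) (sf j)) sx)).
  apply: (@le_lt_trans _ _ (e / (nnorm s x + 1) * nnorm s x)).
    by rewrite ler_wpM2r ?nnorm_ge0// Ae.
  by rewrite mulrAC ltr_pdivrMr// ltr_pM2l// ltrDl.
pose g x := if `[< ndom s x >] then lim (f i x @[i --> F]) else 0.
have gE x : ndom s x -> f i x @[i --> F] --> g x.
  by move=> sx; rewrite /g asboolT//; exact: fcvg.
(* Letting only [j] tend to the limit preserves the Cauchy estimate, uniformly in [x]; this turns
   pointwise convergence into norm convergence. *)
have fg e A : 0 <= e -> F A ->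
    (forall i j, A i -> A j -> dual_norm s (f i - f j) <= e) ->
    forall i x, A i -> ndom s x -> `|f i x - g x| <= e * nnorm s x.
  move=> e0 FA Ae i x Ai sx.
  have : `|f i x - f j x| @[j --> F] --> `|f i x - g x|.
    by apply: cvg_norm; apply: cvgB; [exact: cvg_cst|exact: gE].
  move/cvgr_to_le; apply; apply: filterS FA => j Aj.
  apply: (le_trans (dual_norm_ge sN (subspaceB DS (sf i) (sf j)) sx)).
  by rewrite ler_wpM2r ?nnorm_ge0// Ae.
have sg : dual_dom s g.
  split.
    move=> a x y sx sy; have sxy : ndom s (a *: x + y) by case: sS => _; apply.
    have /cvg_lim <- // := gE _ sxy.
    apply: cvg_lim => //; rewrite (_ : (fun i => _) = fun i => a * f i x + f i y).
      by apply: cvgD; [apply: cvgMr|]; exact: gE.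
    by apply/funext => i; case: (sf i) => ->.
  split; last by move=> x nsx; rewrite /g asboolF.
  have [A FA Ae] := fC 1 ltr01; have [i Ai] := filter_ex FA.
  exists (dual_norm s (f i) + 1) => x sx.
  rewrite -[g x](subrK (f i x)) addrC mulrDl (le_trans (ler_normD _ _))//.
  by apply: lerD; [exact: (dual_norm_ge sN (sf i))|rewrite distrC; exact: (fg 1 A)].
exists g => // e e0; have [A FA Ae] := fC _ e0.
apply: (@filterS _ F _ A _ _ FA) => i Ai.
apply: (dual_norm_le sN (ltW e0)) => x sx.
exact: (fg e A (ltW e0) FA).
Qed.

End BanachNsp.

(** * The Banach space type carried by a Banach subset *)

Section BanachNspType.
Context {R : realType} {s : nsp R} (sB : banach_nsp s).

(** The proof of [banach_nsp s] is an argument so that instances attached to the predicate can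
    recover it by unification. *)
Definition ndom_pred & banach_nsp s : {pred nT s} := fun x => `[< ndom s x >].

Let ndom_pred_submod : submod_closed (ndom_pred sB).
Proof.
have [[[s0 sZD] _ _] _ _] := sB.
split=> [|a x y /asboolP sx /asboolP sy]; apply/asboolP => //.
exact: sZD.
Qed.

HB.instance Definition _ :=
  GRing.isSubmodClosed.Build R (nT s) (ndom_pred sB) ndom_pred_submod.

Record nsp_type := NspType { nval : nT s; nvalP : nval \in ndom_pred sB }.

HB.instance Definition _ := [isSub for nval].
HB.instance Definition _ := [Choice of nsp_type by <:].
HB.instance Definition _ := [SubChoice_isSubLmodule of nsp_type by <:].

Lemma ndom_nval (x : nsp_type) : ndom s (nval x).
Proof. exact/asboolP/nvalP. Qed.

Let nsp_type_norm (x : nsp_type) : R := nnorm s (nval x).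

Let nsp_type_normD x y :
  nsp_type_norm (x + y) <= nsp_type_norm x + nsp_type_norm y.
Proof. by case: sB => -[_ _ sD] _ _; apply: sD; exact: ndom_nval. Qed.

Let nsp_type_normZ (a : R) x :
  nsp_type_norm (a *: x) = `|a| * nsp_type_norm x.
Proof. by case: sB => -[_ sZ _] _ _; apply: sZ; exact: ndom_nval. Qed.

Let nsp_type_norm0 x : nsp_type_norm x = 0 -> x = 0.
Proof.
case: sB => _ s0 _ /(s0 _ (ndom_nval x)) x0; exact/val_inj.
Qed.

HB.instance Definition _ := Lmodule_isNormed.Build R nsp_type
  nsp_type_normD nsp_type_normZ nsp_type_norm0.

Lemma nsp_type_normE (x : nsp_type) : `|x| = nnorm s (nval x).
Proof. by []. Qed.

Let nsp_type_complete (F : set_system nsp_type) :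
  ProperFilter F -> cauchy F -> cvg F.
Proof.
move=> FF /cauchyP Fc; have [_ _ sC] := sB.
have [|e e0|x sx xF] := sC _ F nval FF; first exact: ndom_nval.
  have e20 : 0 < e / 2 by rewrite divr_gt0.
  have [y yF] := Fc _ e20; exists (ball y (e / 2)) => // z w.
  rewrite -ball_normE /= => yz yw.
  suff : `|z - w| <= e by [].
  rewrite [e]splitr -[z](subrK y) -addrA (le_trans (ler_normD _ _))//.
  by rewrite lerD//; [rewrite distrC|]; exact: ltW.
have sx' : x \in ndom_pred sB by exact/asboolP.
apply/cvg_ex; exists (NspType sx'); apply/cvgrPdist_le => e e0.
by apply: filterS (xF e e0) => z; rewrite distrC.
Qed.

HB.instance Definition _ :=
  Uniform_isComplete.Build nsp_type nsp_type_complete.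

Definition nsp_completeType : completeNormedModType R := nsp_type.

Lemma nval_lin (a : R) (x y : nsp_type) :
  nval (a *: x + y) = a *: nval x + nval y.
Proof. by []. Qed.

Lemma mas_banach_to_mas (sO : nclosed setT s) : mas_banach (to_mas sO).
Proof.
pose g (x : {x | ndom s x}) : nsp_type :=
  @NspType (sval x) (asboolT (proj2_sig x)).
exists nsp_completeType, g; split.
  exists (fun y => exist _ (nval y) (ndom_nval y)).
    by move=> [x sx]; apply: eq_exist.
  by move=> y; apply/val_inj.
split=> // c Hc xs; apply/val_inj => /=.
by rewrite (linear_on_lincomb (@setT_subspace R nsp_type)
  (fun a u v _ _ => nval_lin a u v)).
Qed.

End BanachNspType.

(** * Equivalence of the conditions *)

Section Extension.
Context {R : realType} {X : normedModType R} (Y : set X) (lam : R).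
Hypotheses (YS : is_subspace Y) (lam1 : 1 <= lam).

Let lam0 : 0 <= lam. Proof. exact: le_trans lam1. Qed.
Let YN : normed_nsp (subnsp Y). Proof. exact: normed_subnsp. Qed.
Let XN : normed_nsp (nsp_of X). Proof. exact: normed_nsp_of. Qed.

Lemma nsp_sub_ge0 (s : nsp R) x y :
  normed_nsp s -> ndom s x -> ndom s y -> 0 <= nnorm s (x - y).
Proof.
by move=> sN sx sy; apply: nnorm_ge0 => //; apply: subspaceB => //; case: sN.
Qed.

Lemma loc_compl_approx : loc_compl Y lam ->
  forall (s : seq X) (e : R), 0 < e -> exists T : X -> X,
  [/\ forall v, span_of s v -> Y (T v),
      forall (a : R) u v, span_of s u -> span_of s v ->
        T (a *: u + v) = a *: T u + T v,
      forall v, span_of s v -> Y v -> T v = v &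
      forall v, span_of s v -> `|T v| <= (lam + e) * `|v|].
Proof.
move=> lc s e e0; have [T [TY [Tl [TE TN]]]] := lc _ (ex_intro _ s erefl) e e0.
exists T; split=> // v sv; have VS := span_subspace s.
have [C C0 TC] := span_linear_bounded Tl.
by apply: (le_trans (opnorm_ge VS Tl C0 TC sv)); rewrite ler_wpM2r.
Qed.

(** With [D] arbitrary, one statement covers both [Z*] and [Y**] as targets. The limit is taken
    pointwise on [D], so it keeps linearity in the functional variable, the operations in [O] and
    the Lipschitz bound, while the excess [1/n] disappears. *)
Lemma loc_compl_extend (O : set (seq R)) (D : nsp R) (f : X -> nT D -> R) :
  loc_compl Y lam -> normed_nsp D -> @nmorph R O (subnsp Y) (dual D) f ->
  exists h : X -> nT D -> R,
    [/\ @nmorph R O (nsp_of X) (dual D) h, forall y, Y y -> h y = f y &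
        @lipc R (nsp_of X) (dual D) h <= lam * @lipc R (subnsp Y) (dual D) f].
Proof.
move=> lc DN [fdom [flip fop]].
have Y_ge0 x y := @nsp_sub_ge0 (subnsp Y) x y YN.
pose L := @lipc R (subnsp Y) (dual D) f.
have L0 : 0 <= L by exact: lipc_ge0.
have fL y y' z : Y y -> Y y' -> ndom D z ->
    `|f y z - f y' z| <= L * `|y - y'| * nnorm D z.
  move=> Yy Yy' Dz; have fyy' : dual_dom D (f y - f y').
    by apply: subspaceB; [exact: dual_dom_subspace|exact: fdom..].
  apply: (le_trans (dual_norm_ge DN fyy' Dz)); rewrite ler_wpM2r ?nnorm_ge0//.
  exact: (lipcP flip Y_ge0).
have [U [UU Us Un]] := large_ultrafilter X.
have e0 (i : seq X * nat) : 0 < i.2.+1%:R^-1 :> R by rewrite invr_gt0.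
have [T TP] := choice (fun i : seq X * nat => loc_compl_approx lc i.1 (e0 i)).
have near_span x : \forall i \near U, span_of i.1 x.
  by apply: filterS (Us x) => i; exact: mem_span.
have near_T x : \forall i \near U, Y (T i x).
  by apply: filterS (near_span x) => i ix; have [+ _ _ _] := TP i; apply.
have fT0 x z : ~ ndom D z -> \forall i \near U, f (T i x) z = 0.
  move=> nDz; apply: filterS (near_T x) => i /fdom.
  by case=> _ [_ ->].
(* A morphism that only respects [O] may have [f 0] nonzero, hence the first term; [lam + 1]
   dominates every [lam + 1/n]. *)
pose C (x : X) := dual_norm D (f 0) + L * ((lam + 1) * `|x|).
have fTb x z : ndom D z -> \forall i \near U, `|f (T i x) z| <= C x * nnorm D z.
  move=> Dz; near=> i.
  have ix : span_of i.1 x by near: i; exact: near_span.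
  have [TY _ _ TN] := TP i; have Y0 : Y 0 by case: YS.
  rewrite -[f (T i x) z](subrK (f 0 z)) addrC (le_trans (ler_normD _ _))//.
  rewrite mulrDl; apply: lerD; first exact: (dual_norm_ge DN (fdom _ Y0)).
  apply: (le_trans (fL _ _ _ (TY _ ix) Y0 Dz)).
  rewrite ler_wpM2r ?nnorm_ge0// ler_wpM2l// subr0.
  apply: (le_trans (TN _ ix)); rewrite ler_wpM2r// lerD2l.
  by rewrite invf_le1// ler1n.
have fTbdd x z : ubdd U (fun i => f (T i x) z).
  have [Dz|nDz] := pselect (ndom D z).
    by exists (C x * nnorm D z); exact: fTb.
  by exists 0; apply: filterS (fT0 x z nDz) => i ->; rewrite normr0.
pose h x z := glim U (fun i => f (T i x) z).
have hdom x : dual_dom D (h x).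
  split.
    move=> a z w Dz Dw; rewrite -glim_lin//; apply: glim_near_eq => //.
      exact: ubdd_lin.
    by apply: filterS (near_T x) => i /fdom[-> //].
  split; last by move=> z /(fT0 x) fz; exact: glim_near_cst.
  by exists (C x) => z Dz; apply: glim_norm_le; exact: fTb.
have hL x x' : dual_norm D (h x - h x') <= lam * L * `|x - x'|.
  apply: (dual_norm_le DN); first by rewrite !mulr_ge0.
  move=> z Dz; rewrite fctE /= -glimB//; apply/ler_addgt0Pl => e e_gt0.
  pose K := L * `|x - x'| * nnorm D z.
  have K0 : 0 <= K by rewrite !mulr_ge0// nnorm_ge0.
  pose k := Num.truncn (K / e).
  apply: glim_norm_le; near=> i.
  have ix : span_of i.1 x by near: i; exact: near_span.
  have ix' : span_of i.1 x' by near: i; exact: near_span.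
  have [TY Tl _ TN] := TP i; have VS := span_subspace i.1.
  apply: (le_trans (fL _ _ _ (TY _ ix) (TY _ ix') Dz)).
  rewrite -(linear_onB VS Tl)//.
  apply: (@le_trans _ _ ((lam + i.2.+1%:R^-1) * K)).
    rewrite /K [leRHS]mulrA ler_wpM2r ?nnorm_ge0// [leRHS]mulrCA ler_wpM2l//.
    by apply: TN; exact: subspaceB.
  rewrite mulrDl addrC; apply: lerD; last by rewrite /K !mulrA.
  rewrite mulrC ler_pdivrMr// mulrC -ler_pdivrMr//.
  apply: le_trans (ltW (truncnS_gt _)) _.
  by rewrite ler_nat ltnS; near: i; exact: Un.
exists h; split.
- split=> [x _|]; first exact: hdom.
  split; first by exists (lam * L) => x x' _ _; exact: hL.
  move=> c Oc xs _; apply/funext => z; rewrite /lincomb fct_sumE.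
  have [sb sE] := ubdd_glim_sum (index_enum _) (fun k : 'I_(size c) => c`_k)
    (fun k => fTbdd (xs k) z).
  rewrite -[RHS]sE; apply: glim_near_eq => //; near=> i.
  (* A linear combination has finitely many arguments, so eventually all of them lie in the span on
     which [T i] is linear. *)
  have ixs k : span_of i.1 (xs k).
    have : forall k, k \in index_enum 'I_(size c) -> span_of i.1 (xs k).
      near: i; elim: (index_enum _) => [|l r IH]; first exact: nearW.
      apply: filterS2 (near_span (xs l)) IH => i il ir j.
      by rewrite inE => /orP[/eqP ->//|/ir].
    by apply; rewrite mem_index_enum.
  have [TY Tl _ _] := TP i.
  have := linear_on_lincomb (span_subspace i.1) Tl ixs; rewrite /lincomb => ->.
  have := fop c Oc (fun k => T i (xs k)) (fun k => TY _ (ixs k)).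
  by rewrite /lincomb => ->; rewrite fct_sumE.
- move=> y Yy; apply/funext => z; apply: glim_near_cst.
  by apply: filterS (near_span y) => i iy; have [_ _ TE _] := TP i; rewrite TE.
- by apply: lipc_le; [exact: mulr_ge0|move=> x x' _ _; exact: hL].
Unshelve. all: by end_near. Qed.

Lemma canj_nmorph (O : set (seq R)) :
  @nmorph R O (subnsp Y) (dual (dual (subnsp Y))) (canj Y).
Proof.
have canjE y phi : dual_dom (subnsp Y) phi -> canj Y y phi = phi y.
  by move=> phiY; rewrite /canj asboolT.
have DS := dual_dom_subspace (subnsp Y).
have jl (a : R) u v : Y u -> Y v -> canj Y (a *: u + v) = a *: canj Y u + canj Y v.
  move=> Yu Yv; apply/funext => phi; rewrite /canj !fctE.
  case: asboolP => [[phil _]|_]; first exact: phil.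
  by rewrite scaler0 addr0.
have jdom y : Y y -> dual_dom (dual (subnsp Y)) (canj Y y).
  move=> Yy; split.
    move=> a phi psi phiY psiY.
    by rewrite !canjE//; case: DS => _; apply.
  split; last by move=> phi nphi; rewrite /canj asboolF.
  exists `|y| => phi phiY; rewrite canjE// mulrC.
  exact: (dual_norm_ge YN phiY).
split=> //; split; last by move=> c Oc xs Yxs; exact: (linear_on_lincomb YS jl).
exists 1 => x y Yx Yy; rewrite -(linear_onB YS jl)// mul1r.
apply: (dual_norm_le (normed_dual YN)) => //= phi phiY.
rewrite canjE// mulrC; apply: (dual_norm_ge YN phiY).
exact: subspaceB.
Qed.

Lemma canj_lipc : @lipc R (subnsp Y) (dual (dual (subnsp Y))) (canj Y) <= 1.
Proof.
apply: lipc_le => // x y Yx Yy; rewrite mul1r.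
apply: (dual_norm_le (normed_dual YN)) => //= phi phiY.
rewrite /canj !fctE asboolT//.
have -> : phi x - phi y = phi (x - y).
  by rewrite -(linear_onB YS (dual_dom_lin phiY)).
by rewrite mulrC; apply: (dual_norm_ge YN phiY); exact: subspaceB.
Qed.

Lemma cond1_of_loc_compl O : loc_compl Y lam -> cond1 O Y lam.
Proof.
move=> lc Z f fm.
have [h [hm hf hL]] := loc_compl_extend lc (normed_nsp_of Z) fm.
by exists h.
Qed.

Lemma cond2_of_loc_compl O : loc_compl Y lam -> cond2 O Y lam.
Proof.
move=> lc; have [h [hm hf hL]] :=
  loc_compl_extend lc (normed_dual YN) (canj_nmorph O).
exists h; split=> //; split=> //; apply: (le_trans hL).
by rewrite ler_piMr// canj_lipc.
Qed.

Lemma nmorph_bidual_lip O (h : X -> (X -> R) -> R) :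
  @nmorph R O (nsp_of X) (dual (dual (subnsp Y))) h ->
  @lipc R (nsp_of X) (dual (dual (subnsp Y))) h <= lam ->
  forall x x', dual_norm (dual (subnsp Y)) (h x - h x') <= lam * `|x - x'|.
Proof.
move=> [_ [hL _]] hlam x x'.
have X_ge0 u v := @nsp_sub_ge0 (nsp_of X) u v XN.
have /= hxx' := @lipcP R (nsp_of X) (dual (dual (subnsp Y))) h hL X_ge0 x x' I I.
by apply: le_trans hxx' _; rewrite ler_wpM2r.
Qed.

Lemma loc_compl_of_cond2 O : cond2 O Y lam -> loc_compl Y lam.
Proof.
move=> [h [hm [hL hY]]]; apply: (@lipschitz_bidual_loc_compl _ _ _ _ h) => //.
  by move=> x; case: hm => + _; exact.
exact: nmorph_bidual_lip hm hL.
Qed.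

(** Condition (1) is applied to the canonical embedding with [Z] the dual of [Y]. Since [Z] must be
    a type, the extension acts on packaged functionals and is carried back to [Y**] through [mk], an
    inverse of [nval] on the dual. *)
Lemma loc_compl_of_cond1 O : cond1 O Y lam -> loc_compl Y lam.
Proof.
have DB := banach_dual YN.
pose Z : completeNormedModType R := nsp_completeType DB.
pose f (x : X) (z : Z) : R := nval (z : nsp_type DB) x.
have zdom (z : Z) : dual_dom (subnsp Y) (nval (z : nsp_type DB)).
  exact: (@ndom_nval R (dual (subnsp Y)) DB z).
have ZN := normed_nsp_of Z.
have fl (a : R) u v : Y u -> Y v -> f (a *: u + v) = a *: f u + f v.
  move=> Yu Yv; apply/funext => z; rewrite !fctE.
  exact: (dual_dom_lin (zdom z)).
have fle u z : Y u -> `|f u z| <= `|u| * `|z|.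
  by move=> Yu; rewrite mulrC; exact: (dual_norm_ge YN (zdom z)).
have flip x y : Y x -> Y y -> dual_norm (nsp_of Z) (f x - f y) <= 1 * `|x - y|.
  move=> Yx Yy; rewrite -(linear_onB YS fl)// mul1r.
  apply: (dual_norm_le ZN) => // z _; apply: fle; exact: subspaceB.
have fm : @nmorph R O (subnsp Y) (dual (nsp_of Z)) f.
  split.
    move=> y Yy; split; first by move=> a z w _ _; rewrite /f nval_lin.
    split; last by move=> z /(_ I).
    by exists `|y : X| => z _; exact: fle.
  split; first by exists 1.
  by move=> c Oc xs Yxs; exact: (linear_on_lincomb YS fl).
move=> /(_ Z f fm)[h [hm [hf hL]]].
have {}hL : @lipc R (nsp_of X) (dual (nsp_of Z)) h <= lam.
  by apply: (le_trans hL); rewrite ler_piMr//; exact: lipc_le.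
have [hdom [hlip _]] := hm.
have X_ge0 u v := @nsp_sub_ge0 (nsp_of X) u v XN.
have {}hlip x x' z : `|h x z - h x' z| <= lam * `|x - x'| * `|z|.
  have hxx' : dual_dom (nsp_of Z) (h x - h x').
    by apply: subspaceB; [exact: dual_dom_subspace|exact: hdom..].
  apply: (le_trans (dual_norm_ge ZN hxx' (I : ndom (nsp_of Z) z))).
  apply: ler_wpM2r; first exact: normr_ge0.
  have /= hLxx' := @lipcP R (nsp_of X) (dual (nsp_of Z)) h hlip X_ge0 x x' I I.
  by apply: le_trans hLxx' _; rewrite ler_wpM2r.
have mkP (phi : X -> R) : exists z : Z, dual_dom (subnsp Y) phi ->
    nval (z : nsp_type DB) = phi.
  have [phiY|nphiY] := pselect (dual_dom (subnsp Y) phi); last by exists 0.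
  by exists (@NspType R _ DB phi (asboolT phiY)).
have [mk {}mkP] := choice mkP.
have DS := dual_dom_subspace (subnsp Y).
have mk_norm phi : dual_dom (subnsp Y) phi ->
    `|mk phi| = dual_norm (subnsp Y) phi.
  by move=> phiY; rewrite [LHS]nsp_type_normE mkP.
pose h' x phi : R := if `[< dual_dom (subnsp Y) phi >] then h x (mk phi) else 0.
have h'E x phi : dual_dom (subnsp Y) phi -> h' x phi = h x (mk phi).
  by move=> phiY; rewrite /h' asboolT.
apply: (@lipschitz_bidual_loc_compl _ _ _ _ h') => //.
- move=> x; have [hl [[M hM] _]] := hdom x I; split.
    move=> a phi psi phiY psiY.
    have apY : dual_dom (subnsp Y) (a *: phi + psi) by case: DS => _; apply.
    rewrite !h'E// -hl//; congr (h x _); apply/val_inj => /=.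
    by rewrite !mkP.
  split; last by move=> phi nphi; rewrite /h' asboolF.
  by exists M => phi phiY; rewrite h'E//= -mk_norm//; exact: hM.
- move=> x x'; apply: (dual_norm_le (normed_dual YN)).
    by rewrite mulr_ge0.
  move=> phi phiY; rewrite /= -mk_norm//.
  have -> : (h' x - h' x') phi = h x (mk phi) - h x' (mk phi).
    by rewrite -!h'E.
  exact: hlip.
- move=> y Yy; apply/funext => phi; rewrite /canj /h'.
  by case: asboolP => // phiY; rewrite hf// /f mkP.
Qed.

(** Only the values of the approximate retractions on a finite list are kept, so their varying
    domains do not matter. Their weak* limit in [Y**] is Lipschitz with constant [lam], and the
    error on [Y] tends to 0. *)
Lemma loc_compl_of_cond4 O (Ax : mas O -> Prop) :
  cond4 Ax Y lam -> loc_compl Y lam.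
Proof.
move=> c4; have [U [UU Us Un]] := large_ultrafilter X.
have e0 (i : seq X * nat) : 0 < i.2.+1%:R^-1 :> R by rewrite invr_gt0.
have TP0 (i : seq X * nat) : exists T : X -> X,
  [/\ forall x, x \in i.1 -> Y (T x),
      forall x x', x \in i.1 -> x' \in i.1 ->
        `|T x - T x'| <= lam * (1 + i.2.+1%:R^-1) * `|x - x'| &
      forall y, y \in i.1 -> Y y -> `|T y - y| <= i.2.+1%:R^-1].
  have [V [sV [_ [T [[TY [TL _]] [Tlam TE]]]]]] :=
    c4 _ (e0 i) _ (finite_seq i.1).
  exists T; split=> [x /sV /TY//|x x' /sV Vx /sV Vx'|y /sV Vy Yy]; last first.
    exact/ltW/TE.
  have V_ge0 (u v : X) : V u -> V v -> 0 <= `|u - v| by [].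
  have /= TLxx' := @lipcP R (subnsp V) (subnsp Y) T TL V_ge0 x x' Vx Vx'.
  by apply: le_trans TLxx' _; rewrite ler_wpM2r.
have [T TP] := choice TP0.
have e1 (i : seq X * nat) : i.2.+1%:R^-1 <= 1 :> R.
  by rewrite invf_le1// ler1n.
have Y0 : Y 0 by case: YS.
(* The factor 2 bounds [1 + 1/n]; the final 1 bounds the norm of [T i 0], since 0 lies in [Y] and is
   moved by at most [1/n]. *)
pose C (x : X) := lam * 2 * `|x| + 1.
have near_T x : \forall i \near U, Y (T i x).
  by apply: filterS (Us x) => i ix; have [+ _ _] := TP i; apply.
have Tb x phi : dual_dom (subnsp Y) phi -> \forall i \near U,
    `|phi (T i x)| <= C x * dual_norm (subnsp Y) phi.
  move=> phiY; near=> i; have [TY TL TE] := TP i.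
  have ix : x \in i.1 by near: i; exact: Us.
  have i0 : 0 \in i.1 by near: i; exact: Us.
  apply: (le_trans (dual_norm_ge YN phiY (TY _ ix))).
  rewrite mulrC ler_wpM2r ?dual_norm_ge0//=.
  rewrite -[T i x](subrK (T i 0)) (le_trans (ler_normD _ _))//; apply: lerD.
    apply: (le_trans (TL _ _ ix i0)); rewrite subr0 ler_wpM2r// ler_wpM2l//.
    by rewrite -[2]/(1 + 1) lerD2l.
  by have := TE _ i0 Y0; rewrite subr0 => /le_trans; apply.
have Tbdd x phi : dual_dom (subnsp Y) phi -> ubdd U (fun i => phi (T i x)).
  by move=> phiY; exists (C x * dual_norm (subnsp Y) phi); exact: Tb.
pose h x phi := if `[< dual_dom (subnsp Y) phi >]
  then glim U (fun i => phi (T i x)) else 0.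
have hE x phi : dual_dom (subnsp Y) phi -> h x phi = glim U (fun i => phi (T i x)).
  by move=> phiY; rewrite /h asboolT.
have DS := dual_dom_subspace (subnsp Y).
have small (K e : R) : 0 <= K -> 0 < e -> \forall i \near U,
    K * i.2.+1%:R^-1 <= e.
  move=> K0 e_gt0; near=> i.
  rewrite ler_pdivrMr// mulrC -ler_pdivrMr//.
  apply: le_trans (ltW (truncnS_gt _)) _.
  by rewrite ler_nat ltnS; near: i; exact: Un.
apply: (@lipschitz_bidual_loc_compl _ _ _ _ h) => //.
- move=> x; split.
    move=> a phi psi phiY psiY.
    have apY : dual_dom (subnsp Y) (a *: phi + psi) by case: DS => _; apply.
    by rewrite !hE// -glim_lin//; exact: Tbdd.
  split; last by move=> phi nphi; rewrite /h asboolF.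
  by exists (C x) => phi phiY; rewrite hE//; apply: glim_norm_le; exact: Tb.
- move=> x x'; apply: (dual_norm_le (normed_dual YN)); first by rewrite mulr_ge0.
  move=> phi phiY.
  have -> : (h x - h x') phi = glim U (fun i => phi (T i x) - phi (T i x')).
    by rewrite glimB; [rewrite -!hE|exact: Tbdd..].
  apply/ler_addgt0Pl => e e_gt0; apply: glim_norm_le.
  pose K := lam * `|x - x'| * dual_norm (subnsp Y) phi.
  have K0 : 0 <= K by rewrite !mulr_ge0// dual_norm_ge0.
  near=> i; have [TY TL _] := TP i.
  have ix : x \in i.1 by near: i; exact: Us.
  have ix' : x' \in i.1 by near: i; exact: Us.
  have -> : phi (T i x) - phi (T i x') = phi (T i x - T i x').
    by rewrite -(linear_onB YS (dual_dom_lin phiY))//; exact: TY.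
  have YB : Y (T i x - T i x') by apply: subspaceB => //; exact: TY.
  apply: (le_trans (dual_norm_ge YN phiY YB)).
  apply: (@le_trans _ _ (K * i.2.+1%:R^-1 + K)).
    rewrite (_ : K * _ + K = dual_norm (subnsp Y) phi *
      (lam * (1 + i.2.+1%:R^-1) * `|x - x'|)); last by rewrite /K; ring.
    by rewrite ler_wpM2l ?dual_norm_ge0//; exact: TL.
  by rewrite lerD2r; near: i; exact: small.
- move=> y Yy; apply/funext => phi; rewrite /canj /h.
  case: asboolP => // phiY; apply/eqP; rewrite -subr_eq0 -normr_le0.
  have -> : phi y = glim U (fun=> phi y).
    by rewrite (@glim_near_cst _ _ _ _ (phi y))//; exact: nearW.
  rewrite -glimB; [|exact: Tbdd|by exists `|phi y|; exact: nearW].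
  apply/ler_addgt0Pl => e e_gt0; rewrite addr0; apply: glim_norm_le.
  near=> i; have [TY _ TE] := TP i.
  have iy : y \in i.1 by near: i; exact: Us.
  have YB : Y (T i y - y) by apply: subspaceB => //; exact: TY.
  have -> : phi (T i y) - phi y = phi (T i y - y).
    by rewrite -(linear_onB YS (dual_dom_lin phiY))//; exact: TY.
  apply: (le_trans (dual_norm_ge YN phiY YB)).
  apply: (@le_trans _ _ (dual_norm (subnsp Y) phi * i.2.+1%:R^-1)).
    by rewrite ler_wpM2l ?dual_norm_ge0//; exact: TE.
  by near: i; apply: small => //; exact: dual_norm_ge0.
Unshelve. all: by end_near. Qed.

Lemma cond4_of_cond3 O (Ax : mas O -> Prop) : cond3 Ax Y lam -> cond4 Ax Y lam.
Proof.
move=> c3 e e0 G Gf; have [V [GV [Vo [T [Tm [TL TE]]]]]] := c3 e e0 G Gf.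
exists V; split=> //; split=> //; exists T; split=> //; split=> // v Vv Yv.
by rewrite TE// subrr normr0.
Qed.

End Extension.

(** The object [V] is the span of [G]: finite-dimensional, hence closed and Banach, hence an object
    of any category containing the Banach spaces. *)
Lemma cond3_of_loc_compl (R : realType) (X : completeNormedModType R)
    (Y : set X) (lam : R) (O : set (seq R)) (Ax : mas O -> Prop) :
  1 <= lam -> contains_banach Ax -> loc_compl Y lam -> cond3 Ax Y lam.
Proof.
move=> lam1 AxB lc e e0 G /finite_seqP[s ->].
have lam0 : 0 < lam by exact: lt_le_trans lam1.
(* The tolerance [lam * e] turns the additive bound [lam + lam * e] into [lam * (1 + e)]. *)
have le0 : 0 < lam * e by rewrite mulr_gt0.
have VS := span_subspace s.
have [T [TY Tl TE TN]] := loc_compl_approx lc s le0.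
exists (span_of s); split; first by move=> x; exact: mem_span.
have Vc : nclosed setT (subnsp (span_of s)).
  move=> c _ xs sxs; apply: subspace_sum => // k _; exact: subspaceZ.
split.
  exists (fun c _ => Vc c I); apply: (AxB (to_mas Vc)).
  apply: mas_banach_to_mas; apply: banach_subnsp => //; exact: span_closed.
have TL x y : span_of s x -> span_of s y ->
    `|T x - T y| <= lam * (1 + e) * `|x - y|.
  move=> sx sy; rewrite -(linear_onB VS Tl)// mulrDr mulr1; apply: TN.
  exact: subspaceB.
exists T; split.
  split=> //; split; first by exists (lam * (1 + e)).
  by move=> c Oc xs sxs; exact: (linear_on_lincomb VS Tl).
split; last exact: TE.
by apply: lipc_le => //; rewrite mulr_ge0 ?addr_ge0// ltW.
Qed.

Lemma contains_banach_Ax_banach (R : realType) : contains_banach (@Ax_banach R).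
Proof.
move=> s sB; split; last first.
  have [E [g [gb [gd gop]]]] := sB; exists E, g; split=> //; split=> //.
  by move=> c [] xs; exact: gop.
have [E [g [/bij_inj gi [gd _]]]] := sB; rewrite /restrict /=.
split; first by move=> x y; rewrite -gd.
split.
  move=> x y; rewrite -gd; split=> [/eqP|->]; last by rewrite subrr normr0.
  by rewrite normr_eq0 subr_eq0 => /eqP/gi.
split=> [x y|x y z]; first by rewrite -!gd distrC.
by rewrite -!gd -(subrKA (g y)) ler_normD.
Qed.

Theorem theorem3p2 (R : realType) (X : completeNormedModType R) (Y : set X)
  (hY : is_subspace Y) (hYc : closed Y) (lam : R) (hlam : 1 <= lam) :
  (loc_compl Y lam <->
     exists h : X -> ((X -> R) -> R),
       (forall x, dual_dom (dual (subnsp Y)) (h x)) /\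
       (forall x x', dual_norm (dual (subnsp Y)) (h x - h x') <= lam * `|x - x'|) /\
       (forall y, Y y -> h y = canj Y y)) /\
  (forall (O : set (seq R)) (Ax : mas O -> Prop),
     contains_banach Ax -> nice Ax ->
     (cond1 O Y lam <-> loc_compl Y lam) /\
     (cond2 O Y lam <-> loc_compl Y lam) /\
     (cond3 Ax Y lam <-> loc_compl Y lam) /\
     (cond4 Ax Y lam <-> loc_compl Y lam)) /\
  ((cond1 setT Y lam <-> loc_compl Y lam) /\
   (cond2 setT Y lam <-> loc_compl Y lam) /\
   (cond3 (@Ax_banach R) Y lam <-> loc_compl Y lam) /\
   (cond4 (@Ax_banach R) Y lam <-> loc_compl Y lam)).
Proof.
(* Uniformity in [O] and [Ax] makes the category of Banach spaces the instance [setT],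
   [Ax_banach]. *)
have conds (O : set (seq R)) (Ax : mas O -> Prop) : contains_banach Ax ->
    (cond1 O Y lam <-> loc_compl Y lam) /\
    (cond2 O Y lam <-> loc_compl Y lam) /\
    (cond3 Ax Y lam <-> loc_compl Y lam) /\
    (cond4 Ax Y lam <-> loc_compl Y lam).
  move=> AxB.
  split; first by split; [exact: loc_compl_of_cond1|exact: cond1_of_loc_compl].
  split; first by split; [exact: loc_compl_of_cond2|exact: cond2_of_loc_compl].
  split; split.
  - by move=> /cond4_of_cond3; exact: loc_compl_of_cond4.
  - exact: cond3_of_loc_compl.
  - exact: loc_compl_of_cond4.
  - by move=> lc; apply: cond4_of_cond3; exact: cond3_of_loc_compl.
split; last first.
  split; first by move=> O Ax AxB nAx; exact: conds.
  by apply: conds; exact: contains_banach_Ax_banach.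
split=> [lc|[h [hdom [hL hE]]]].
  have [h [hm [hL hE]]] := @cond2_of_loc_compl _ _ _ _ hY hlam setT lc.
  exists h; split; first by move=> x; case: hm => + _; exact.
  by split=> //; exact: nmorph_bidual_lip hm hL.
apply: (@lipschitz_bidual_loc_compl _ _ _ _ h) => //.
exact: le_trans hlam.
Qed.
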